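(* For every integer $n\ge 0$, the functor $I^{\otimes 2}\otimes\Lambda^n$ is artinian of type $2$.
   Context: $\mathcal{E}$ is the category of $\mathbb{F}_2$-vector spaces, $\mathcal{E}^f$ its full subcategory of finite-dimensional spaces, and $\mathcal{F}$ is the (abelian) category of functors $\mathcal{E}^f\to\mathcal{E}$; $\otimes$ on $\mathcal{F}$ is the pointwise tensor product over $\mathbb{F}_2$. $\Lambda^n$ is the $n$-th exterior power functor. $I$ is the functor $V\mapsto \mathbb{F}_2^{V^*}$ (all set-theoretic functions $V^*\to\mathbb{F}_2$). The notions ''simple artinian of type $m$'' and ''artinian of type $m$'' are defined by induction on $m\in\mathbb{N}$: a simple artinian functor of type $0$ is a simple functor; a simple artinian functor of type $m+1$ is a functor that is not artinian of type $m$ but all of whose strict subobjects are artinian of type $m$; an artinian functor of type $m$ is a functor having a finite filtration whose subquotients are simple artinian of types $\le m$. *)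

(* Defs.v *)
From HB Require Import structures.
From mathcomp Require Import all_boot all_order all_algebra.
From mathcomp Require Import boolp classical_sets functions.
From mathcomp Require Import finmap monalg.

Set Implicit Arguments.
Unset Strict Implicit.
Unset Printing Implicit Defensive.

Import GRing.Theory.
Local Open Scope ring_scope.
Local Open Scope quotient_scope.

Section Submodules.
Variables (R : comNzRingType) (M : lmodType R).

Section Sub.
Variable N : submodClosed M.

Definition submodule : Type := {x : M | x \in N}.

HB.instance Definition _ := SubChoice.on submodule.
HB.instance Definition _ := [SubChoice_isSubLmodule of submodule by <:].

(* The library builds the quotient by any subgroup; [N] is turned into a
   [zmodClosed] predicate and scalars are added to that quotient. *)
Definition submod_zmod : {pred M} := fun x => x \in N.

Fact submod_zmod_closed : zmod_closed submod_zmod.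
Proof. exact: GRing.subsemimod_closedB (GRing.subsemimodClosedP N). Qed.

HB.instance Definition _ :=
  GRing.isZmodClosed.Build M submod_zmod submod_zmod_closed.

Definition quotmod : Type := Quotient.quot submod_zmod.

HB.instance Definition _ := GRing.Zmodule.on quotmod.

Definition cls (x : M) : quotmod := \pi_(Quotient.quot submod_zmod) x.

Definition rep (q : quotmod) : M := repr (q : Quotient.quot submod_zmod).

Lemma repK : cancel rep cls. Proof. exact: reprK. Qed.

Lemma cls_eq x y : cls x = cls y <-> x - y \in N.
Proof.
split=> [/eqP|xy]; first by rewrite -Quotient.idealrBE.
by apply/eqP; rewrite -Quotient.idealrBE.
Qed.

Lemma cls_eq0 x : cls x = 0 <-> x \in N.
Proof.
have -> : 0 = cls 0 by rewrite /cls raddf0.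
by rewrite cls_eq subr0.
Qed.

Lemma repB x : rep (cls x) - x \in N.
Proof. by apply/cls_eq; rewrite repK. Qed.

Lemma clsD x y : cls (x + y) = cls x + cls y.
Proof. by rewrite /cls raddfD. Qed.

Definition quotient_scale a (q : quotmod) : quotmod := cls (a *: rep q).

Lemma quotient_scaleE a x : quotient_scale a (cls x) = cls (a *: x).
Proof. by apply/cls_eq; rewrite -scalerBr rpredZ // repB. Qed.

Fact quotient_scaleA a b q :
  quotient_scale a (quotient_scale b q) = quotient_scale (a * b) q.
Proof. by rewrite -[q]repK !quotient_scaleE scalerA. Qed.

Fact quotient_scale1 : left_id 1 quotient_scale.
Proof. by move=> q; rewrite -[q]repK !quotient_scaleE scale1r. Qed.

Fact quotient_scaleDr : right_distributive quotient_scale +%R.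
Proof.
by move=> a p q; rewrite -[p]repK -[q]repK -clsD !quotient_scaleE -clsD scalerDr.
Qed.

Fact quotient_scaleDl q : {morph quotient_scale^~ q : a b / a + b}.
Proof. by move=> a b; rewrite -[q]repK !quotient_scaleE -clsD scalerDl. Qed.

HB.instance Definition _ := GRing.Zmodule_isLmodule.Build R quotmod
  quotient_scaleA quotient_scale1 quotient_scaleDr quotient_scaleDl.

Fact cls_linear : linear cls.
Proof. by move=> a x y; rewrite clsD -[cls (_ *: _)]quotient_scaleE. Qed.

HB.instance Definition _ := GRing.isLinear.Build R M quotmod _ cls cls_linear.

End Sub.

Definition spanned (A : M -> Prop) : {pred M} :=
  fun x => `[< forall N : submodClosed M,
                 (forall r, A r -> r \in N) -> x \in N >].

Fact span_submod_closed A : subsemimod_closed (spanned A).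
Proof.
split; first split.
- by apply/asboolP => N _; rewrite rpred0.
- move=> x y /asboolP xA /asboolP yA; apply/asboolP => N AN.
  by rewrite rpredD ?xA ?yA.
- move=> a x /asboolP xA; apply/asboolP => N AN.
  by rewrite rpredZ ?xA.
Qed.

HB.instance Definition _ A :=
  GRing.isSubmodClosed.Build R M (spanned A) (span_submod_closed A).

Lemma mem_span (A : M -> Prop) x : A x -> x \in spanned A.
Proof. by move=> Ax; apply/asboolP => N; apply. Qed.

Definition preim_submod (M' : lmodType R) (f : {linear M' -> M})
  (N : submodClosed M) : {pred M'} := fun x => f x \in N.

Fact preim_submod_closed M' f N : subsemimod_closed (@preim_submod M' f N).
Proof.
split; first split.
- by rewrite /in_mem /= /preim_submod linear0 rpred0.
- move=> x y; rewrite /in_mem /= /preim_submod => xN yN; rewrite linearD; exact: rpredD.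
- move=> a x; rewrite /in_mem /= /preim_submod => xN; rewrite linearZ; exact: rpredZ.
Qed.

HB.instance Definition _ M' f N :=
  GRing.isSubmodClosed.Build R M' (@preim_submod M' f N)
    (preim_submod_closed f N).

End Submodules.

Section InducedMaps.
Variables (R : comNzRingType) (M M' : lmodType R) (f : {linear M -> M'}).
Variables (N : submodClosed M) (N' : submodClosed M').
Hypothesis fN : forall x, x \in N -> f x \in N'.

Definition submodule_map (x : submodule N) : submodule N' :=
  Sub (f (val x)) (fN (valP x)).

Fact submodule_map_linear : linear submodule_map.
Proof.
by move=> a x y; apply: val_inj; rewrite /= linearP.
Qed.

HB.instance Definition _ := GRing.isLinear.Build R (submodule N)
  (submodule N') _ submodule_map submodule_map_linear.

Definition quotient_map_fun (q : quotmod N) : quotmod N' :=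
  cls N' (f (rep q)).

Fact quotient_map_funE x : quotient_map_fun (cls N x) = cls N' (f x).
Proof. by apply/cls_eq; rewrite -linearB fN ?repB. Qed.

Fact quotient_map_linear : linear quotient_map_fun.
Proof.
move=> a p q; rewrite -[p]repK -[q]repK -linearP !quotient_map_funE.
by rewrite !linearP.
Qed.

Definition quotient_map : {linear quotmod N -> quotmod N'} :=
  HB.pack_for {linear quotmod N -> quotmod N'} quotient_map_fun
    (GRing.isLinear.Build R _ _ _ quotient_map_fun quotient_map_linear).

Lemma quotient_mapE x : quotient_map (cls N x) = cls N' (f x).
Proof. exact: quotient_map_funE. Qed.

End InducedMaps.

Section Presentations.
Variable R : comNzRingType.

Section FreeExtension.
Variables (X : choiceType) (M : lmodType R) (h : X -> M).

Definition free_ext (g : {malg R[X]}) : M := \sum_(x <- msupp g) g@_x *: h x.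

Lemma free_extEw (g : {malg R[X]}) (d : {fset X}) :
  (msupp g `<=` d)%fset -> free_ext g = \sum_(x <- d) g@_x *: h x.
Proof.
move=> gd; rewrite /free_ext; apply: big_fset_incl => // x _ /mcoeff_outdom ->.
by rewrite scale0r.
Qed.

Fact free_ext_linear : linear free_ext.
Proof.
move=> a g1 g2; pose d := (msupp g1 `|` msupp g2 `|` msupp (a *: g1 + g2))%fset.
rewrite !(@free_extEw _ d);
  try by apply/fsubsetP => x; rewrite !in_fsetU => ->; rewrite ?orbT.
rewrite scaler_sumr -big_split /=; apply: eq_bigr => x _.
by rewrite mcoeffD mcoeffZ scalerDl scalerA.
Qed.

HB.instance Definition _ := GRing.isLinear.Build R {malg R[X]} M _
  free_ext free_ext_linear.

Lemma free_extU x : free_ext << x >> = h x.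
Proof. by rewrite /free_ext msuppU oner_eq0 big_seq_fset1 mcoeffUU scale1r. Qed.

End FreeExtension.

Section Presented.
Variables (X : choiceType) (A : {malg R[X]} -> Prop).

(* The module with generators [X] and relations [A]. *)
Definition presented : lmodType R := quotmod (spanned A).

Definition pgen (x : X) : presented := cls (spanned A) << x >>.

Lemma presented_ext (M : lmodType R) (f g : {linear presented -> M}) :
  (forall x, f (pgen x) = g (pgen x)) -> f =1 g.
Proof.
move=> fg q; rewrite -[q]repK [rep q]monalgE !linear_sum.
apply: eq_bigr => x _; set c := (rep q)@_x.
have -> : << c *g x >> = c *: (<< x >> : {malg R[X]}).
  by apply/malgP => k; rewrite mcoeffZ !mcoeffU mulrnAr mulr1.
by rewrite !linearZ /= -/(pgen x) fg.
Qed.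

Section Lift.
Variables (M : lmodType R) (h : X -> M).
Hypothesis hA : forall r, A r -> free_ext h r = 0.

Definition lift_fun (q : presented) : M := free_ext h (rep q).

Lemma free_ext_span r : r \in spanned A -> free_ext h r = 0.
Proof.
have K0 : subsemimod_closed (fun r => free_ext h r == 0).
  split; first split.
  - by rewrite /in_mem /= linear0.
  - by move=> x y; rewrite /in_mem /= => /eqP x0 /eqP y0;
    rewrite linearD /= x0 y0 addr0.
  - by move=> a x; rewrite /in_mem /= => /eqP x0; rewrite linearZ /= x0 scaler0.
pose mK := GRing.isSubmodClosed.Build R _ _ K0.
pose K : submodClosed _ := HB.pack (fun r => free_ext h r == 0) mK.
by move=> /asboolP/(_ K) rK; apply/eqP/rK => s As; apply/eqP/hA.
Qed.

Fact lift_fun_cls g : lift_fun (cls _ g) = free_ext h g.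
Proof. by apply/eqP; rewrite -subr_eq0 -linearB /= free_ext_span ?repB. Qed.

Fact lift_linear : linear lift_fun.
Proof.
move=> a p q; rewrite -[p]repK -[q]repK -[_ + _]linearP !lift_fun_cls.
by rewrite linearP.
Qed.

Definition plift : {linear presented -> M} :=
  HB.pack_for {linear presented -> M} lift_fun
    (GRing.isLinear.Build R _ _ _ lift_fun lift_linear).

Lemma plift_gen x : plift (pgen x) = h x.
Proof. by rewrite /= lift_fun_cls free_extU. Qed.

End Lift.
End Presented.
End Presentations.

Section TensorProduct.
Variable R : comNzRingType.

Inductive tensor_rel (U W : lmodType R) : {malg R[(U * W)%type]} -> Prop :=
| TensorRelL a u u' w : tensor_rel
    (<< (a *: u + u', w) >> - (a *: << (u, w) >> + << (u', w) >>))
| TensorRelR a u w w' : tensor_rel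
    (<< (u, a *: w + w') >> - (a *: << (u, w) >> + << (u, w') >>)).

Definition tensor (U W : lmodType R) : lmodType R :=
  presented (@tensor_rel U W).

Definition ptensor (U W : lmodType R) (u : U) (w : W) : tensor U W :=
  pgen (@tensor_rel U W) (u, w).

Lemma ptensorPl (U W : lmodType R) a (u u' : U) (w : W) :
  ptensor (a *: u + u') w = a *: ptensor u w + ptensor u' w.
Proof.
rewrite /ptensor /pgen -linearP; apply/cls_eq/mem_span; exact: TensorRelL.
Qed.

Lemma ptensorPr (U W : lmodType R) a (u : U) (w w' : W) :
  ptensor u (a *: w + w') = a *: ptensor u w + ptensor u w'.
Proof.
rewrite /ptensor /pgen -linearP; apply/cls_eq/mem_span; exact: TensorRelR.
Qed.

Section Map.
Variables (U U' W W' : lmodType R).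
Variables (f : {linear U -> U'}) (g : {linear W -> W'}).

Definition ptensor_map (p : U * W) : tensor U' W' := ptensor (f p.1) (g p.2).

Fact ptensor_map_rel r : tensor_rel r -> free_ext ptensor_map r = 0.
Proof.
case=> [a u u' w|a u w w']; rewrite linearB linearP /= !free_extU /ptensor_map /=.
- by rewrite linearP ptensorPl subrr.
- by rewrite linearP ptensorPr subrr.
Qed.

Definition tensor_map : {linear tensor U W -> tensor U' W'} :=
  plift ptensor_map_rel.

Lemma tensor_mapE u w : tensor_map (ptensor u w) = ptensor (f u) (g w).
Proof. exact: plift_gen. Qed.

End Map.
End TensorProduct.

Section ExteriorPower.
Variables (R : comNzRingType) (n : nat).

Definition ffset (V : choiceType) (v : {ffun 'I_n -> V}) (i : 'I_n) (x : V) :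
  {ffun 'I_n -> V} := [ffun j => if j == i then x else v j].

(* In characteristic 2 the relations have to be the alternating ones: the
   antisymmetric ones would give the larger quotient of coinvariants. *)
Inductive ext_rel (V : lmodType R) : {malg R[{ffun 'I_n -> V}]} -> Prop :=
| ExtRelLin (v : {ffun 'I_n -> V}) i a x y : ext_rel
    (<< ffset v i (a *: x + y) >> - (a *: << ffset v i x >> + << ffset v i y >>))
| ExtRelAlt (v : {ffun 'I_n -> V}) i j : i != j -> v i = v j -> ext_rel << v >>.

Definition ext_power (V : lmodType R) : lmodType R := presented (@ext_rel V).

Definition wedge (V : lmodType R) (v : {ffun 'I_n -> V}) : ext_power V :=
  pgen (@ext_rel V) v.

Lemma wedgeP (V : lmodType R) (v : {ffun 'I_n -> V}) i a x y :
  wedge (ffset v i (a *: x + y))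
  = a *: wedge (ffset v i x) + wedge (ffset v i y).
Proof.
rewrite /wedge /pgen -linearP; apply/cls_eq/mem_span; exact: ExtRelLin.
Qed.

Lemma wedge_alt (V : lmodType R) (v : {ffun 'I_n -> V}) i j :
  i != j -> v i = v j -> wedge v = 0.
Proof. by move=> ij vij; apply/cls_eq0/mem_span; apply: ExtRelAlt ij vij. Qed.

Section Map.
Variables (V W : lmodType R) (f : {linear V -> W}).

Definition wedge_map (v : {ffun 'I_n -> V}) : ext_power W :=
  wedge [ffun i => f (v i)].

Fact wedge_map_rel r : ext_rel r -> free_ext wedge_map r = 0.
Proof.
case=> [v i a x y|v i j ij vij]; last first.
  by rewrite free_extU; apply: wedge_alt ij _; rewrite !ffunE vij.
rewrite linearB linearP /= !free_extU.
have E z : wedge_map (ffset v i z) = wedge (ffset [ffun k => f (v k)] i (f z)).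
  by congr wedge; apply/ffunP => k; rewrite !ffunE (fun_if f).
by rewrite !E linearP wedgeP subrr.
Qed.

Definition ext_power_map : {linear ext_power V -> ext_power W} :=
  plift wedge_map_rel.

Lemma ext_power_mapE v : ext_power_map (wedge v) = wedge [ffun i => f (v i)].
Proof. exact: plift_gen. Qed.

End Map.
End ExteriorPower.

Record functor := Functor {
  fobj :> vectType 'F_2 -> lmodType 'F_2;
  fmap : forall V W : vectType 'F_2, 'Hom(V, W) -> {linear fobj V -> fobj W};
  fmap_id : forall (V : vectType 'F_2) (x : fobj V), fmap \1%VF x = x;
  fmap_comp : forall (U V W : vectType 'F_2) (g : 'Hom(V, W)) (f : 'Hom(U, V))
    (x : fobj U), fmap (g \o f)%VF x = fmap g (fmap f x) }.

Arguments fmap F {V W} f : rename.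

(* Subspaces are boolean predicates; classically this loses no subfunctor. *)
Record subfunctor (F : functor) := Subfunctor {
  sub_at :> forall V : vectType 'F_2, submodClosed (F V);
  sub_stable : forall (V W : vectType 'F_2) (f : 'Hom(V, W)) (x : F V),
    x \in sub_at V -> fmap F f x \in sub_at W }.

Section SubQuotient.
Variables (F : functor) (G : subfunctor F).

Definition subF_map (V W : vectType 'F_2) (f : 'Hom(V, W)) :
  {linear submodule (G V) -> submodule (G W)} :=
  submodule_map (@sub_stable F G V W f).

Fact subF_id (V : vectType 'F_2) x : @subF_map V V \1%VF x = x.
Proof. by apply: val_inj; rewrite /= fmap_id. Qed.

Fact subF_comp (U V W : vectType 'F_2) (g : 'Hom(V, W)) (f : 'Hom(U, V)) x :
  subF_map (g \o f)%VF x = subF_map g (subF_map f x).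
Proof. by apply: val_inj; rewrite /= fmap_comp. Qed.

Definition subF : functor := Functor subF_id subF_comp.

Definition quotF_map (V W : vectType 'F_2) (f : 'Hom(V, W)) :
  {linear quotmod (G V) -> quotmod (G W)} :=
  quotient_map (@sub_stable F G V W f).

Fact quotF_id (V : vectType 'F_2) x : @quotF_map V V \1%VF x = x.
Proof. by rewrite -[x]repK quotient_mapE fmap_id. Qed.

Fact quotF_comp (U V W : vectType 'F_2) (g : 'Hom(V, W)) (f : 'Hom(U, V)) x :
  quotF_map (g \o f)%VF x = quotF_map g (quotF_map f x).
Proof. by rewrite -[x]repK /quotF_map !quotient_mapE fmap_comp. Qed.

Definition quotF : functor := Functor quotF_id quotF_comp.

Section Trace.
Variable H : subfunctor F.

Definition traceF_at (V : vectType 'F_2) : submodClosed (subF V) :=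
  preim_submod (val : {linear submodule (G V) -> F V}) (H V).

Fact traceF_stable (V W : vectType 'F_2) (f : 'Hom(V, W)) (x : subF V) :
  x \in traceF_at V -> fmap subF f x \in traceF_at W.
Proof. exact: sub_stable. Qed.

(* [H] cut down to a subfunctor of the functor [subF]. *)
Definition traceF : subfunctor subF := Subfunctor traceF_stable.

End Trace.
End SubQuotient.

(* [subquotF G H] is G/H when [H] is contained in [G]. *)
Definition subquotF (F : functor) (G H : subfunctor F) : functor :=
  quotF (traceF G H).

Definition subf_le (F : functor) (H G : subfunctor F) : Prop :=
  forall V : vectType 'F_2, {subset H V <= G V}.

Definition is_zero (F : functor) (G : subfunctor F) : Prop :=
  forall (V : vectType 'F_2) (x : F V), x \in G V -> x = 0.

Definition is_full (F : functor) (G : subfunctor F) : Prop :=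
  forall (V : vectType 'F_2) (x : F V), x \in G V.

Definition simple_functor (F : functor) : Prop :=
  (exists (V : vectType 'F_2) (x : F V), x != 0) /\
  forall G : subfunctor F, is_zero G \/ is_full G.

Definition has_filtration (S : functor -> Prop) (F : functor) : Prop :=
  exists (k : nat) (fil : nat -> subfunctor F),
    [/\ is_zero (fil 0%N), is_full (fil k) &
        forall i, (i < k)%N ->
          subf_le (fil i) (fil i.+1) /\ S (subquotF (fil i.+1) (fil i))].

(* Both predicates are needed in the recursion: simple artinian of type m, and
   simple artinian of some type at most m; [simple_artinianS] below recovers the
   usual clause for m.+1. *)
Fixpoint simple_artinian_pair (m : nat) :
    (functor -> Prop) * (functor -> Prop) :=
  match m with
  | 0 => (simple_functor, simple_functor)
  | m'.+1 =>
      let le_m' := (simple_artinian_pair m').2 in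
      let eq_m := fun F : functor =>
        ~ has_filtration le_m' F /\
        forall G : subfunctor F, ~ is_full G -> has_filtration le_m' (subF G) in
      (eq_m, fun F => le_m' F \/ eq_m F)
  end.

Definition simple_artinian (m : nat) : functor -> Prop :=
  (simple_artinian_pair m).1.

Definition artinian (m : nat) : functor -> Prop :=
  has_filtration (fun F => exists2 i, (i <= m)%N & simple_artinian i F).

Lemma simple_artinian0 F : simple_artinian 0 F <-> simple_functor F.
Proof. by []. Qed.

Lemma simple_artinianS m F : simple_artinian m.+1 F <->
  ~ artinian m F /\
  forall G : subfunctor F, ~ is_full G -> artinian m (subF G).
Proof.
suff E : (simple_artinian_pair m).2 =
    (fun F => exists2 i, (i <= m)%N & simple_artinian i F).
  by rewrite /simple_artinian /= E.
elim: m => [|m IHm]; apply/funext => H; apply/propext.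
  by split=> [?|[[|//] _]//]; exists 0%N.
rewrite /= IHm; split.
- case=> [[i im iH]|SH]; first by exists i => //; exact: leqW.
  by exists m.+1 => //; rewrite /simple_artinian /= IHm.
- case=> i; rewrite leq_eqVlt => /orP[/eqP->|im iH]; last by left; exists i.
  by rewrite /simple_artinian /= IHm; right.
Qed.

Section InjectiveFunctor.

Definition I_obj (V : vectType 'F_2) : lmodType 'F_2 :=
  ('Hom(V, ('F_2)^o) -> ('F_2)^o)%type.

Definition precomp_dual (V W : vectType 'F_2) (f : 'Hom(V, W))
  (u : I_obj V) : I_obj W := fun phi => u (phi \o f)%VF.

Fact precomp_dual_linear (V W : vectType 'F_2) (f : 'Hom(V, W)) :
  linear (precomp_dual f).
Proof. by []. Qed.

HB.instance Definition _ (V W : vectType 'F_2) (f : 'Hom(V, W)) :=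
  GRing.isLinear.Build _ (I_obj V) (I_obj W) _
    (precomp_dual f) (precomp_dual_linear f).

Definition I_map (V W : vectType 'F_2) (f : 'Hom(V, W)) :
  {linear I_obj V -> I_obj W} := precomp_dual f.

Fact I_id (V : vectType 'F_2) x : @I_map V V \1%VF x = x.
Proof. by apply/funext => phi; rewrite /I_map /= /precomp_dual comp_lfun1r. Qed.

Fact I_comp (U V W : vectType 'F_2) (g : 'Hom(V, W)) (f : 'Hom(U, V)) x :
  I_map (g \o f)%VF x = I_map g (I_map f x).
Proof. by apply/funext => phi; rewrite /I_map /= /precomp_dual comp_lfunA. Qed.

Definition Ifun : functor := Functor I_id I_comp.

End InjectiveFunctor.

Section TensorFunctor.
Variables F G : functor.

Definition tensorF_map (V W : vectType 'F_2) (f : 'Hom(V, W)) :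
  {linear tensor (F V) (G V) -> tensor (F W) (G W)} :=
  tensor_map (fmap F f) (fmap G f).

Fact tensorF_id (V : vectType 'F_2) x : @tensorF_map V V \1%VF x = x.
Proof.
apply: (presented_ext (g := idfun)) => -[u w].
by apply: etrans (tensor_mapE _ _ u w) _; rewrite !fmap_id.
Qed.

Fact tensorF_comp (U V W : vectType 'F_2) (g : 'Hom(V, W)) (f : 'Hom(U, V)) x :
  tensorF_map (g \o f)%VF x = tensorF_map g (tensorF_map f x).
Proof.
apply: (presented_ext (g := tensorF_map g \o tensorF_map f)) => -[u w].
have E (V1 W1 : vectType 'F_2) (h : 'Hom(V1, W1)) a b :
  tensorF_map h (ptensor a b) = ptensor (fmap F h a) (fmap G h b).
  exact: tensor_mapE.
apply: etrans (E _ _ _ u w) (esym _).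
by apply: etrans (congr1 _ (E _ _ f u w)) _; rewrite E !fmap_comp.
Qed.

Definition tensorF : functor := Functor tensorF_id tensorF_comp.

End TensorFunctor.

Section ExteriorFunctor.
Variable n : nat.

Definition Lambda_map (V W : vectType 'F_2) (f : 'Hom(V, W)) :
  {linear ext_power n V -> ext_power n W} := ext_power_map n f.

Fact Lambda_id (V : vectType 'F_2) x : @Lambda_map V V \1%VF x = x.
Proof.
apply: (presented_ext (g := idfun)) => v.
apply: etrans (ext_power_mapE _ v) _; congr wedge.
by apply/ffunP => i; rewrite ffunE /= id_lfunE.
Qed.

Fact Lambda_comp (U V W : vectType 'F_2) (g : 'Hom(V, W)) (f : 'Hom(U, V)) x :
  Lambda_map (g \o f)%VF x = Lambda_map g (Lambda_map f x).
Proof.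
apply: (presented_ext (g := Lambda_map g \o Lambda_map f)) => v.
have E (V1 W1 : vectType 'F_2) (h : 'Hom(V1, W1)) u :
  Lambda_map h (wedge u) = wedge [ffun i => h (u i)].
  exact: ext_power_mapE.
apply: etrans (E _ _ _ v) (esym _).
apply: etrans (congr1 _ (E _ _ f v)) _; rewrite E; congr wedge.
by apply/ffunP => i; rewrite !ffunE /= comp_lfunE.
Qed.

Definition Lambda : functor := Functor Lambda_id Lambda_comp.

End ExteriorFunctor.

(* Main.v *)
From HB Require Import structures.
From mathcomp Require Import all_boot all_order all_algebra all_fingroup.
From mathcomp Require Import boolp functions finmap monalg.
Require Import Defs.

(** Work on the spaces 'rV_k. Evaluating at two linear forms and at n further
    forms (through a minor) embeds I (x) I (x) Lambda^n in the functor
    k |-> {functions 'M_(k, 2 + n) -> F_2}, on which a linear map acts by left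
    multiplication of the argument; the image lies in the functions of degree at
    most n in the last n columns ([ev_injective], [ev_degree]). Let P(m, r, e) be
    the functor of the functions on 'M_(k, m + r) that have degree less than e in
    the last r columns ([polyfam]). An interval of subfunctors has Krull dimension
    at most m when it satisfies the descending chain condition and when almost all
    steps of an ascending chain have dimension at most m - 1 ([krull]). It is shown
    that P(m, r, e) has dimension at most m for m = 0, 1, 2 ([krull_poly2]), and an
    argument on preorders turns this into a filtration with simple artinian
    subquotients ([krull_small_interval], [krull_artinian]).

    The bound for P(m, r, e) goes by induction on m ([krull_step]). A subfunctor
    G determines a subset of a fixed finite set: the natural operators c from
    functions of m + r columns to functions of m + e columns such that c(u), for
    every u in G, has degree less than e in the last e columns and is killed by a
    product of differences along nonzero vectors of F_2^m in the first m columns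
    ([leading]). This set decreases when G grows, so it is enough to treat G'
    inside G with the same set. The key fact ([leading_inclusion]) is that G'
    contains a function u as soon as the operators of G' kill u and u vanishes
    where the first m columns have rank less than m. Indeed a linear form
    orthogonal to G' is a sum of evaluations; those whose first m columns have a
    kernel different from that of a given one are killed by differences along
    vectors in the first kernel and outside the second, while polynomiality in
    the last columns bounds how often this has to be repeated. Hence G/G' embeds
    in a sum of copies of P(m - 1, r, e) and of functors K of functions killed by
    products of differences, and it remains to bound K. The same inclusion holds
    for the intersection of a descending chain, which gives the chain condition.

    For m = 1 there is a single nonzero vector and K consists of functions of
    bounded degree. For m = 2 there are three nonzero vectors, and K lies in the
    sum of three functors of functions of bounded degree along one vector
    ([split_directions]). With a basis adapted to the three vectors this would be
    a count of coordinates, but the linear forms l_a, l_b, l_c that vanish on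
    them satisfy l_a + l_b + l_c = 0. Their tensor squares are linearly
    independent, so the count works after the rows have been grouped in pairs. *)

Set Implicit Arguments.
Unset Strict Implicit.
Unset Printing Implicit Defensive.

Import GRing.Theory.
Local Open Scope ring_scope.

(** * Krull dimension of intervals in a preorder *)

Section KrullDimension.
Variables (T : Type) (le : T -> T -> Prop).
Hypothesis le_refl : forall x, le x x.
Hypothesis le_trans : forall x y z, le x y -> le y z -> le x z.

Definition between (a b x : T) : Prop := le a x /\ le x b.

(** The interval from a to b satisfies the descending chain condition and has
    codeviation (the dual Krull dimension) less than n. *)
Fixpoint krull (n : nat) (a b : T) : Prop :=
  match n with
  | 0 => le b a
  | n'.+1 =>
      (forall s : nat -> T, (forall i, between a b (s i)) ->
         (forall i, le (s i.+1) (s i)) ->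
         exists N, forall i, (N <= i)%N -> le (s N) (s i)) /\
      (forall s : nat -> T, (forall i, between a b (s i)) ->
         (forall i, le (s i) (s i.+1)) ->
         exists N, forall i, (N <= i)%N -> krull n' (s i) (s i.+1))
  end.

Lemma descending (s : nat -> T) (i j : nat) :
  (forall i, le (s i.+1) (s i)) -> (i <= j)%N -> le (s j) (s i).
Proof.
move=> ds; elim: j => [|j IHj]; first by rewrite leqn0 => /eqP->.
rewrite leq_eqVlt => /orP[/eqP->//|]; rewrite ltnS => /IHj; exact: le_trans.
Qed.

Lemma krull_le n a b : le b a -> krull n a b.
Proof.
elim: n a b => //= n IHn a b ba; split=> s sab _; exists 0%N => i _.
  by apply: le_trans (sab 0%N).2 (le_trans ba (sab i).1).
by apply: IHn; apply: le_trans (sab i.+1).2 (le_trans ba (sab i).1).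
Qed.

Lemma krull_dcc n a b (s : nat -> T) : krull n a b ->
  (forall i, between a b (s i)) -> (forall i, le (s i.+1) (s i)) ->
  exists N, forall i, (N <= i)%N -> le (s N) (s i).
Proof.
case: n => [/= ba sab _|n [dcc _]]; last exact: dcc.
by exists 0%N => i _; apply: le_trans (sab 0%N).2 (le_trans ba (sab i).1).
Qed.

Lemma krull_minimal n a b (P : T -> Prop) : krull n a b ->
  forall x, between a b x -> P x ->
  exists2 y, between a x y & P y /\
    (forall z, between a y z -> P z -> le y z).
Proof.
move=> kab x0 x0ab Px0; apply: contrapT => noy.
have next (x : {x | between a x0 x /\ P x}) :
    {y : {x | between a x0 x /\ P x} |
      le (sval y) (sval x) /\ ~ le (sval x) (sval y)}.
  case: x => x [ax Px]; apply: cid; apply: contrapT => nox.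
  apply: noy; exists x => //; split=> // z [az zx] Pz.
  apply: contrapT => xz; apply: nox.
  have az0 : between a x0 z by split=> //; exact: le_trans zx ax.2.
  by exists (exist _ z (conj az0 Pz)).
have x00 : between a x0 x0 by split=> //; exact: x0ab.1.
pose t := fix t i := if i is j.+1 then sval (next (t j))
                     else exist _ x0 (conj x00 Px0).
have tab i : between a b (sval (t i)).
  case: (t i) => y [[ay y0] _] /=; split=> //; exact: le_trans y0 x0ab.2.
have dt i : le (sval (t i.+1)) (sval (t i)).
  by rewrite /=; case: (next (t i)) => ? [].
have [N /(_ N.+1 (leqnSn N))] := krull_dcc kab tab dt.
by rewrite /=; case: (next (t N)) => ? [].
Qed.

End KrullDimension.

Section Transfer.
Variables (T1 T2 : Type) (le1 : T1 -> T1 -> Prop) (le2 : T2 -> T2 -> Prop).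
Hypothesis le1_refl : forall x, le1 x x.
Hypothesis le1_trans : forall x y z, le1 x y -> le1 y z -> le1 x z.

(** A monotone map that is strict on comparable pairs cannot lower the dimension.
    It serves for images and preimages along natural transformations and, in
    modular lattices, for the maps that cut an interval into two. *)
Lemma krull_transfer (th : T1 -> T2) n a b : le1 a b ->
  (forall x y, between le1 a b x -> between le1 a b y -> le1 x y ->
     le2 (th x) (th y) /\ (le2 (th y) (th x) -> le1 y x)) ->
  krull le2 n (th a) (th b) -> krull le1 n a b.
Proof.
elim: n a b => [|n IHn] a b ab thP /=.
  by have [_] := thP a b (conj (le1_refl a) ab) (conj ab (le1_refl b)) ab.
have thab x : between le1 a b x -> between le2 (th a) (th b) (th x).
  move=> xab; have [ax xb] := xab; split.
    by case: (thP a x (conj (le1_refl a) ab) xab ax).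
  by case: (thP x b xab (conj ab (le1_refl b)) xb).
move=> [dcc acc]; split=> s sab ms.
  have [i|i|N sN] := dcc (th \o s).
  - exact/thab/sab.
  - by case: (thP _ _ (sab i.+1) (sab i) (ms i)).
  exists N => i Ni.
  have siN : le1 (s i) (s N) by apply: descending ms Ni.
  by case: (thP _ _ (sab i) (sab N) siN) => _; apply; apply: sN.
have [i|i|N sN] := acc (th \o s).
- exact/thab/sab.
- by case: (thP _ _ (sab i) (sab i.+1) (ms i)).
exists N => i Ni; apply: IHn (sN i Ni); first exact: ms.
move=> x y [ix xi] [iy yi]; apply: thP; split.
- exact: le1_trans (sab i).1 ix.
- exact: le1_trans xi (sab i.+1).2.
- exact: le1_trans (sab i).1 iy.
- exact: le1_trans yi (sab i.+1).2.
Qed.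

End Transfer.

Lemma krull_between (T : Type) (le : T -> T -> Prop)
  (le_refl : forall x, le x x)
  (le_trans : forall x y z, le x y -> le y z -> le x z) n a b c d :
  krull le n a b -> le a c -> le d b -> krull le n c d.
Proof.
move=> kab ac db; case: n kab => [|n] /= => [ba|[dcc acc]].
  exact: le_trans db (le_trans _ _ _ ba ac).
have cdab x : between le c d x -> between le a b x.
  move=> [cx xd]; split; [exact: le_trans ac cx | exact: le_trans xd db].
by split=> s scd; [apply: dcc | apply: acc] => i; apply/cdab/scd.
Qed.

Section Product.
Variables (T1 T2 : Type) (le1 : T1 -> T1 -> Prop) (le2 : T2 -> T2 -> Prop).
Hypothesis le1_refl : forall x, le1 x x.
Hypothesis le2_refl : forall x, le2 x x.
Hypothesis le1_trans : forall x y z, le1 x y -> le1 y z -> le1 x z.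
Hypothesis le2_trans : forall x y z, le2 x y -> le2 y z -> le2 x z.

Definition le_prod (x y : T1 * T2) : Prop := le1 x.1 y.1 /\ le2 x.2 y.2.

Lemma krull_prod n a b :
  krull le1 n a.1 b.1 -> krull le2 n a.2 b.2 -> krull le_prod n a b.
Proof.
elim: n a b => //= n IHn a b [dcc1 acc1] [dcc2 acc2].
have ab1 (s : nat -> T1 * T2) : (forall i, between le_prod a b (s i)) ->
    forall i, between le1 a.1 b.1 (s i).1.
  by move=> sab i; split; [exact: (sab i).1.1 | exact: (sab i).2.1].
have ab2 (s : nat -> T1 * T2) : (forall i, between le_prod a b (s i)) ->
    forall i, between le2 a.2 b.2 (s i).2.
  by move=> sab i; split; [exact: (sab i).1.2 | exact: (sab i).2.2].
split=> s sab ms.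
  have [N sN] := dcc1 _ (ab1 s sab) (fun i => proj1 (ms i)).
  have [M sM] := dcc2 _ (ab2 s sab) (fun i => proj2 (ms i)).
  exists (maxn N M) => i; rewrite geq_max => /andP[Ni Mi]; split.
    apply: le1_trans (sN i Ni).
    exact: (@descending _ _ le1_refl le1_trans (fun i => (s i).1) _ _
             (fun i => proj1 (ms i)) (leq_maxl N M)).
  apply: le2_trans (sM i Mi).
  exact: (@descending _ _ le2_refl le2_trans (fun i => (s i).2) _ _
           (fun i => proj2 (ms i)) (leq_maxr N M)).
have [N sN] := acc1 _ (ab1 s sab) (fun i => proj1 (ms i)).
have [M sM] := acc2 _ (ab2 s sab) (fun i => proj2 (ms i)).
exists (maxn N M) => i; rewrite geq_max => /andP[Ni Mi].
by apply: IHn; [exact: sN | exact: sM].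
Qed.

End Product.

Section TypeOfIntervals.
Variables (T : Type) (le : T -> T -> Prop).
Hypothesis le_refl : forall x, le x x.
Hypothesis le_trans : forall x y z, le x y -> le y z -> le x z.

(** Consecutive intervals share their end on the nose, so a step can be put in
    front of a chain without replacing ends by equivalent ones. *)
Inductive chain (S : T -> T -> Prop) : T -> T -> Prop :=
| ChainNil a b : le a b -> le b a -> chain S a b
| ChainCons a c b : le a c -> S a c -> chain S c b -> chain S a b.

Lemma chain_le S a b : chain S a b -> le a b.
Proof. by elim=> // {}a c {}b ac _ _; apply: le_trans. Qed.

Lemma chain_sub (S S' : T -> T -> Prop) a b :
  (forall x y, S x y -> S' x y) -> chain S a b -> chain S' a b.
Proof.
move=> SS'; elim=> {a b} [a b|a c b ac /SS' Sac _]; first exact: ChainNil.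
exact: ChainCons.
Qed.

Definition simple_interval (a b : T) : Prop :=
  ~ le b a /\ forall c, le a c -> le c b -> le c a \/ le b c.

(** The recursion of [simple_artinian_pair], for intervals of a preorder. *)
Fixpoint simple_pair (m : nat) : (T -> T -> Prop) * (T -> T -> Prop) :=
  match m with
  | 0 => (simple_interval, simple_interval)
  | m'.+1 =>
      let le_m' := (simple_pair m').2 in
      let eq_m := fun a b => ~ chain le_m' a b /\
        forall c, le a c -> le c b -> ~ le b c -> chain le_m' a c in
      (eq_m, fun a b => le_m' a b \/ eq_m a b)
  end.

(** Artinian of type less than m, where type less than 0 means trivial. *)
Definition small_interval (m : nat) (a b : T) : Prop :=
  if m is m'.+1 then chain (simple_pair m').2 a b else le b a.

Lemma small_interval_chain m a b :
  le a b -> small_interval m a b -> small_interval m.+1 a b.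
Proof.
case: m => [|m] ab /=; first exact: ChainNil.
by apply: chain_sub => x y; left.
Qed.

(** Above any x from which b is not reached by a chain, take a minimal y such
    that the interval from x to y is not small: everything strictly below y is
    small, so the step from x to y is simple. Repeating this, the steps are not
    small, so the ascending chain has to reach b. *)
Lemma krull_small_interval m a b : le a b -> krull le m a b -> small_interval m a b.
Proof.
elim: m a b => // m IHm a b ab kab; apply: contrapT => nab.
have [dcc acc] := kab.
have next (x : {x | between le a b x /\ ~ small_interval m.+1 x b}) :
    {y : {x | between le a b x /\ ~ small_interval m.+1 x b} |
      le (sval x) (sval y) /\ ~ small_interval m (sval x) (sval y)}.
  case: x => x [xab nxb]; apply: cid.
  have nb : ~ small_interval m x b.
    by move=> xb; apply: nxb; apply: small_interval_chain xb; case: xab.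
  have xb : between le x b b by split=> //; case: xab.
  have kxb : krull le m.+1 x b.
    apply: (krull_between le_refl le_trans kab) => //; exact: xab.1.
  have [y [xy yb] [ny ymin]] :=
    krull_minimal le_refl le_trans (P := fun y => ~ small_interval m x y) kxb xb nb.
  have Sxy : (simple_pair m).2 x y.
    have below z : le x z -> le z y -> ~ le y z -> small_interval m x z.
      by move=> xz zy nyz; apply: contrapT => nz; apply: nyz; apply: ymin.
    case: m {IHm kab dcc acc nab nxb nb kxb ymin} ny below => [|m] ny below /=.
      split=> // z xz zy; case: (pselect (le y z)) => yz; first by right.
      by left; apply: below.
    by right.
  have yab : between le a b y by split=> //; exact: le_trans xab.1 xy.
  have nyb : ~ small_interval m.+1 y b by move=> cyb; apply: nxb; apply: ChainCons cyb.
  by exists (exist _ y (conj yab nyb)).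
have aab : between le a b a by split.
pose t := fix t i := if i is j.+1 then sval (next (t j))
                     else exist _ a (conj aab nab).
have tab i : between le a b (sval (t i)) by case: (t i) => x [].
have mt i : le (sval (t i)) (sval (t i.+1)).
  by rewrite /=; case: (next (t i)) => ? [].
have [N /(_ N (leqnn N)) kN] := acc (fun i => sval (t i)) tab mt.
have : ~ small_interval m (sval (t N)) (sval (t N.+1)).
  by rewrite /=; case: (next (t N)) => ? [].
by apply; apply: IHm kN; apply: mt.
Qed.

End TypeOfIntervals.

(** * Artinian types are read off the lattice of subfunctors *)

Lemma F2_cases (a : 'F_2) : a = 0 \/ a = 1.
Proof.
case: a => [[|[|//]]] lt_i; first by left; apply: val_inj.
by right; apply: val_inj.
Qed.

Section SubfunctorOfProp.
Variables (F : functor) (P : forall V : vectType 'F_2, F V -> Prop).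
Hypothesis P0 : forall V : vectType 'F_2, P (0 : F V).
Hypothesis PD : forall (V : vectType 'F_2) (x y : F V), P x -> P y -> P (x + y).
Hypothesis Pmap : forall (V W : vectType 'F_2) (f : 'Hom(V, W)) (x : F V),
  P x -> P (fmap F f x).

Definition prop_at (V : vectType 'F_2) : {pred F V} := fun x => `[< P x >].

Fact prop_at_closed (V : vectType 'F_2) : subsemimod_closed (@prop_at V).
Proof.
split; first split.
- exact/asboolP/P0.
- by move=> x y /asboolP Px /asboolP Py; apply/asboolP/PD.
- move=> a x /asboolP Px; apply/asboolP.
  by case: (F2_cases a) => ->; rewrite ?scale0r ?scale1r //; apply: P0.
Qed.

HB.instance Definition _ (V : vectType 'F_2) :=
  GRing.isSubmodClosed.Build 'F_2 (F V) (@prop_at V) (@prop_at_closed V).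

Fact prop_at_stable (V W : vectType 'F_2) (f : 'Hom(V, W)) (x : F V) :
  x \in @prop_at V -> fmap F f x \in @prop_at W.
Proof. by move=> /asboolP Px; apply/asboolP/Pmap. Qed.

Definition sub_of_prop : subfunctor F :=
  Subfunctor (sub_at := fun V => @prop_at V) prop_at_stable.

Lemma sub_of_propE (V : vectType 'F_2) (x : F V) :
  (x \in sub_of_prop V) <-> P x.
Proof. by split=> [/asboolP //|Px]; apply/asboolP. Qed.

End SubfunctorOfProp.

Definition zero_sub (F : functor) : subfunctor F.
Proof.
apply: (@sub_of_prop F (fun _ x => x = 0)) => //.
- by move=> V x y -> ->; rewrite addr0.
- by move=> V W f x ->; rewrite linear0.
Defined.

Definition full_sub (F : functor) : subfunctor F.
Proof. by apply: (@sub_of_prop F (fun _ _ => True)). Defined.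

Lemma zero_subE (F : functor) (V : vectType 'F_2) (x : F V) :
  (x \in zero_sub F V) <-> x = 0.
Proof. exact: sub_of_propE. Qed.

Lemma full_subE (F : functor) (V : vectType 'F_2) (x : F V) : x \in full_sub F V.
Proof. exact/sub_of_propE. Qed.

Lemma is_zeroE F (G : subfunctor F) : is_zero G <-> forall H, subf_le G H.
Proof.
split=> [G0 H V x /G0->|GH V x /(GH (zero_sub F)) /zero_subE //].
by rewrite rpred0.
Qed.

Lemma is_fullE F (G : subfunctor F) : is_full G <-> forall H, subf_le H G.
Proof.
split=> [G1 H V x _|GH V x]; first exact: G1.
by apply: (GH (full_sub F)); apply: full_subE.
Qed.

Section SubquotientLattice.
Variables (F : functor) (G H : subfunctor F).
Hypothesis HG : subf_le H G.
Let Q := subquotF G H.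

Definition cls_in (V : vectType 'F_2) (x : subF G V) : Q V :=
  cls (traceF G H V) x.

(** Subfunctors of G/H correspond to the subfunctors between H and G. *)
Definition unquot (K : subfunctor Q) : subfunctor F.
Proof.
apply: (@sub_of_prop F (fun V x =>
  exists2 y : submodule (G V), val y = x & cls_in y \in K V)).
- by move=> V; exists 0; rewrite ?raddf0 // /cls_in linear0 rpred0.
- move=> V _ _ [x <- Kx] [y <- Ky]; exists (x + y); rewrite ?raddfD //.
  by rewrite /cls_in linearD rpredD.
- move=> V W f _ [x <- Kx]; exists (fmap (subF G) f x) => //.
  have -> : cls_in (fmap (subF G) f x) = fmap Q f (cls_in x).
    exact/esym/quotient_mapE.
  exact: sub_stable.
Defined.

Lemma unquotE K (V : vectType 'F_2) (y : submodule (G V)) :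
  (val y \in unquot K V) <-> cls_in y \in K V.
Proof.
split=> [/sub_of_propE [z /val_inj -> //]|Ky]; apply/sub_of_propE.
by exists y.
Qed.

Lemma unquot_sub K : subf_le (unquot K) G.
Proof. by move=> V x /sub_of_propE [y <- _]; apply: valP. Qed.

Lemma sub_unquot K : subf_le H (unquot K).
Proof.
move=> V x xH; pose y : submodule (G V) := Sub x (HG xH).
have -> : x = val y by [].
apply/unquotE; have -> : cls_in y = 0 by apply/cls_eq0.
exact: rpred0.
Qed.

Lemma unquot_le K1 K2 : subf_le K1 K2 <-> subf_le (unquot K1) (unquot K2).
Proof.
split=> K12 V x; first by move=> /sub_of_propE [y <- /K12 Ky]; apply/unquotE.
by rewrite -[x]repK => Kx; apply/unquotE/K12/unquotE.
Qed.

Lemma unquot_surj (L : subfunctor F) : subf_le H L -> subf_le L G ->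
  exists K, subf_le (unquot K) L /\ subf_le L (unquot K).
Proof.
move=> HL LG.
pose P (V : vectType 'F_2) (q : Q V) :=
  exists2 y : submodule (G V), cls_in y = q & val y \in L V.
have P0 (V : vectType 'F_2) : P V 0.
  by exists 0; [exact: linear0 | exact: rpred0].
have PD (V : vectType 'F_2) (x y : Q V) : P V x -> P V y -> P V (x + y).
  move=> [x' <- Lx] [y' <- Ly]; exists (x' + y'); first exact: linearD.
  exact: rpredD.
have Pmap (V W : vectType 'F_2) (f : 'Hom(V, W)) (x : Q V) :
    P V x -> P W (fmap Q f x).
  move=> [y <- Ly]; exists (fmap (subF G) f y); last exact: (sub_stable f Ly).
  exact/esym/quotient_mapE.
exists (sub_of_prop P0 PD Pmap); split=> V x.
  move=> /sub_of_propE [y <- /sub_of_propE [z /cls_eq zy Lz]].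
  have {}zy : val z - val y \in H V by move: zy; rewrite -raddfB.
  have -> : (val y : F V) = val z + (-1) *: (val z - val y).
    by rewrite scaleN1r subKr.
  by apply: rpredD => //; apply/rpredZ/HL.
move=> Lx; pose y : submodule (G V) := Sub x (LG V x Lx).
have -> : x = val y by [].
by apply/unquotE/sub_of_propE; exists y.
Qed.

End SubquotientLattice.

Section SubLattice.
Variables (F : functor) (G : subfunctor F).

Definition incl (K : subfunctor (subF G)) : subfunctor F.
Proof.
apply: (@sub_of_prop F (fun V x => exists2 y, val y = x & y \in K V)).
- by move=> V; exists 0; rewrite ?raddf0 // rpred0.
- by move=> V _ _ [x <- Kx] [y <- Ky]; exists (x + y); rewrite ?rpredD.
- move=> V W f _ [x <- Kx]; exists (fmap (subF G) f x) => //.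
  exact: sub_stable.
Defined.

Lemma inclE K (V : vectType 'F_2) (y : subF G V) :
  (val y \in incl K V) <-> y \in K V.
Proof.
split=> [/sub_of_propE [z /val_inj <- //]|Ky]; apply/sub_of_propE.
by exists y.
Qed.

Lemma incl_sub K : subf_le (incl K) G.
Proof. by move=> V x /sub_of_propE [y <- _]; apply: valP. Qed.

Lemma incl_le K1 K2 : subf_le K1 K2 <-> subf_le (incl K1) (incl K2).
Proof.
split=> K12 V x; first by move=> /sub_of_propE [y <- /K12 Ky]; apply/inclE.
by move=> Kx; apply/inclE/K12/inclE.
Qed.

Lemma incl_surj (L : subfunctor F) : subf_le L G ->
  exists K, subf_le (incl K) L /\ subf_le L (incl K).
Proof.
move=> LG; exists (traceF G L); split=> V x.
  by move=> /sub_of_propE [y <- Ly].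
move=> Lx; pose y : submodule (G V) := Sub x (LG V x Lx).
by have -> : x = val y by []; apply/inclE.
Qed.

End SubLattice.

Lemma subf_refl F (G : subfunctor F) : subf_le G G.
Proof. by move=> V x. Qed.

Lemma subf_trans F (G H K : subfunctor F) :
  subf_le G H -> subf_le H K -> subf_le G K.
Proof. by move=> GH HK V x /GH /HK. Qed.

Section Models.
Variables (T : Type) (le : T -> T -> Prop).
Hypothesis le_refl : forall x, le x x.
Hypothesis le_trans : forall x y z, le x y -> le y z -> le x z.

Definition eqv x y := le x y /\ le y x.

(** An isomorphism, up to equivalence, from the lattice of subfunctors of F to an
    interval. All subquotients of a functor are modelled in the same preorder, so
    nested subquotients never have to be compared directly. *)
Record models (F : functor) (a b : T) : Type := Models {
  mod_at :> subfunctor F -> T;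
  mod_le : forall G H, subf_le G H <-> le (mod_at G) (mod_at H);
  mod_between : forall G, between le a b (mod_at G);
  mod_surj : forall c, between le a b c -> exists G, eqv (mod_at G) c }.

Lemma mod_zero F a b (th : models F a b) G : is_zero G <-> eqv (th G) a.
Proof.
rewrite is_zeroE; split=> [G0|[Ga _] H].
  split; last by case: (mod_between th G).
  have [|H [Ha _]] := mod_surj th (c := a).
    by split=> //; case: (mod_between th G) => ab; apply: le_trans.
  by apply: le_trans Ha; apply/(mod_le th).
by apply/(mod_le th)/(le_trans Ga); case: (mod_between th H).
Qed.

Lemma mod_full F a b (th : models F a b) G : is_full G <-> eqv (th G) b.
Proof.
rewrite is_fullE; split=> [G1|[_ Gb] H].
  split; first by case: (mod_between th G).
  have [|H [_ Hb]] := mod_surj th (c := b).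
    by split=> //; case: (mod_between th G) => ab; apply: le_trans.
  by apply: le_trans Hb _; apply/(mod_le th).
by apply/(mod_le th); apply: le_trans Gb; case: (mod_between th H).
Qed.

Lemma models_subquot F a b (th : models F a b) G H c d :
  subf_le H G -> eqv (th H) c -> eqv (th G) d -> models (subquotF G H) c d.
Proof.
move=> HG [Hc cH] [Gd dG].
apply: (@Models _ _ _ (fun K => th (unquot K))).
- by move=> K1 K2; rewrite unquot_le (mod_le th).
- move=> K; split.
    by apply: le_trans cH _; apply/(mod_le th)/sub_unquot.
  by apply: le_trans _ Gd; apply/(mod_le th)/unquot_sub.
- move=> x [cx xd].
  have [|L [Lx xL]] := mod_surj th (c := x).
    split; first exact: le_trans (mod_between th H).1 (le_trans Hc cx).
    exact: le_trans xd (le_trans dG (mod_between th G).2).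
  have [||K [KL LK]] := unquot_surj (H := H) (G := G) (L := L).
  + apply/(mod_le th); exact: le_trans Hc (le_trans cx xL).
  + apply/(mod_le th); exact: le_trans Lx (le_trans xd dG).
  exists K; split.
    by apply: le_trans _ Lx; apply/(mod_le th).
  by apply: le_trans xL _; apply/(mod_le th).
Qed.

Lemma models_sub F a b (th : models F a b) G d :
  eqv (th G) d -> models (subF G) a d.
Proof.
move=> [Gd dG]; apply: (@Models _ _ _ (fun K => th (incl K))).
- by move=> K1 K2; rewrite incl_le (mod_le th).
- move=> K; split; first by case: (mod_between th (incl K)).
  by apply: le_trans _ Gd; apply/(mod_le th)/incl_sub.
- move=> x [ax xd].
  have [|L [Lx xL]] := mod_surj th (c := x).
    split=> //; exact: le_trans xd (le_trans dG (mod_between th G).2).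
  have [|K [KL LK]] := incl_surj (G := G) (L := L).
    apply/(mod_le th); exact: le_trans Lx (le_trans xd dG).
  exists K; split.
    by apply: le_trans _ Lx; apply/(mod_le th).
  by apply: le_trans xL _; apply/(mod_le th).
Qed.

Lemma filtration_chain (S : functor -> Prop) (S' : T -> T -> Prop) :
  (forall F a b, models F a b -> S F <-> S' a b) ->
  forall F a b, models F a b -> has_filtration S F <-> chain le S' a b.
Proof.
move=> SS' F a b th; split=> [[k [fil [f0 fk filP]]]|].
  have step i : (i <= k)%N -> forall c, eqv (th (fil (k - i)%N)) c ->
      chain le S' c b.
    elim: i => [|i IHi] ik c [fc cf].
      have [fb bf] := (mod_full th _).1 fk; rewrite subn0 in fc cf.
      by apply: ChainNil; [exact: le_trans fb | exact: le_trans fc].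
    have ki : (k - i.+1).+1 = (k - i)%N by rewrite subnSK.
    have [|ff Sfil] := filP (k - i.+1)%N.
      by rewrite ltn_subrL (leq_ltn_trans (leq0n i) ik).
    rewrite ki in ff Sfil.
    apply: (ChainCons (c := th (fil (k - i)%N))).
    - by apply: le_trans cf _; apply/(mod_le th).
    - apply/(SS' _ _ _ (models_subquot (th := th) ff _ _)) => //.
    - by apply: IHi (ltnW ik) _ _.
  by apply: (step k) => //; rewrite subnn; apply/(mod_zero th).
move=> cab.
suff: forall c d, chain le S' c d -> between le a b c -> eqv d b ->
    forall G, eqv (th G) c -> exists (k : nat) (fil : nat -> subfunctor F),
    [/\ fil 0%N = G, is_full (fil k) & forall i, (i < k)%N ->
      subf_le (fil i) (fil i.+1) /\ S (subquotF (fil i.+1) (fil i))].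
  have ab := chain_le le_trans cab.
  have aab : between le a b a by split.
  have [G Ga] := mod_surj th aab.
  move=> /(_ a b cab aab (conj (le_refl b) (le_refl b)) G Ga).
  move=> [k [fil [f0 fk filP]]].
  by exists k, fil; split=> //; rewrite f0; apply/(mod_zero th).
move=> c d; elim=> {c d} [c d cd dc|c e d ce Sce ced IH] [ac cb] [db bd] G [Gc cG].
  exists 0%N, (fun=> G); split=> //; apply/(mod_full th); split.
    exact: le_trans Gc cb.
  exact: le_trans bd (le_trans dc cG).
have eb : le e b by apply: le_trans db; apply: chain_le ced.
have aeb : between le a b e by split=> //; exact: le_trans ac ce.
have [H He] := mod_surj th aeb.
have [k [fil [f0 fk filP]]] := IH aeb (conj db bd) H He.
have GH : subf_le G H.
  by apply/(mod_le th); exact: le_trans Gc (le_trans ce He.2).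
exists k.+1, (fun i => if i is j.+1 then fil j else G); split=> // -[_|i ik].
  rewrite f0; split=> //; apply/(SS' _ c e) => //.
  exact: (models_subquot (th := th) GH).
exact: filP.
Qed.

(** Both components are needed, since simplicity of type m + 1 refers negatively
    to filtrations of type at most m. *)
Lemma simple_artinianE m F a b : models F a b ->
  ((simple_artinian_pair m).1 F <-> (simple_pair le m).1 a b) /\
  ((simple_artinian_pair m).2 F <-> (simple_pair le m).2 a b).
Proof.
elim: m F a b => [|m IHm] F a b th /=.
  suff E : simple_functor F <-> simple_interval le a b by [].
  split=> [[[V [x x0]] Fs]|[nba Fs]].
    have aab : between le a b (th (zero_sub F)) by exact: mod_between.
    split=> [ba|c ac cb].
      have : is_zero (full_sub F).
        apply/(mod_zero th); split; last exact: (mod_between _ _).1.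
        exact: le_trans (mod_between th _).2 ba.
      by move=> /(_ V x (full_subE x)) x1; rewrite x1 eqxx in x0.
    have [G [Gc cG]] := mod_surj th (conj ac cb).
    case: (Fs G) => [/(mod_zero th) [Ga _]|/(mod_full th) [_ bG]].
      by left; exact: le_trans cG Ga.
    by right; exact: le_trans bG Gc.
  split=> [|G].
    apply: contrapT => no; apply: nba.
    have f0 : is_zero (full_sub F).
      move=> V x _; apply: contrapT => x0; apply: no.
      by exists V, x; apply/eqP.
    have f1 : is_full (full_sub F) by move=> V x; exact: full_subE.
    have [fa _] := (mod_zero th _).1 f0; have [_ bf] := (mod_full th _).1 f1.
    exact: le_trans bf fa.
  case: (mod_between th G) => aG Gb.
  case: (Fs _ aG Gb) => [Ga|bG]; first by left; apply/(mod_zero th).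
  by right; apply/(mod_full th).
have E F' a' b' : models F' a' b' ->
    has_filtration (simple_artinian_pair m).2 F' <->
    chain le (simple_pair le m).2 a' b'.
  by apply: filtration_chain => F1 a1 b1 /IHm [].
suff E1 : (~ has_filtration (simple_artinian_pair m).2 F /\
    forall G : subfunctor F, ~ is_full G ->
      has_filtration (simple_artinian_pair m).2 (subF G)) <->
    (~ chain le (simple_pair le m).2 a b /\
     forall c, le a c -> le c b -> ~ le b c ->
       chain le (simple_pair le m).2 a c).
  by split=> //; have [_ E2] := IHm F a b th; rewrite E1 E2.
rewrite (E _ _ _ th); split=> -[nF sF]; split=> //.
  move=> c ac cb nbc; have [G Gc] := mod_surj th (conj ac cb).
  apply/(E _ _ _ (models_sub (th := th) Gc)); apply: sF => /(mod_full th) [_ bG].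
  exact/nbc/(le_trans bG)/Gc.1.
move=> G nG; have [aG Gb] := mod_between th G.
apply/(E _ _ _ (models_sub (th := th) (conj (le_refl _) (le_refl _)))).
by apply: sF => // bG; apply/nG/(mod_full th).
Qed.

End Models.

Definition models_self F : models (@subf_le F) F (zero_sub F) (full_sub F).
Proof.
apply: (@Models _ _ _ _ _ id) => // [G|G _].
  by split=> V x; [move=> /zero_subE ->; exact: rpred0 | move=> _; exact: full_subE].
by exists G; split=> V x.
Defined.

Lemma le_simple_artinian m F : (simple_artinian_pair m).2 F ->
  exists2 i, (i <= m)%N & simple_artinian i F.
Proof.
elim: m => [|m IHm] /=; first by exists 0%N.
case=> [/IHm[i im sF]|sF]; first by exists i => //; exact: leqW.
by exists m.+1.
Qed.

Lemma krull_artinian m F :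
  krull (@subf_le F) m.+1 (zero_sub F) (full_sub F) -> artinian m F.
Proof.
move=> /(krull_small_interval (@subf_refl F) (@subf_trans F)) kF.
have le_zf : subf_le (zero_sub F) (full_sub F) by move=> V x _; exact: full_subE.
have /= c := kF le_zf.
have [k [fil [f0 fk filP]]] : has_filtration (simple_artinian_pair m).2 F.
  have E F' a b (th : models (@subf_le F) F' a b) :=
    (simple_artinianE (@subf_refl F) (@subf_trans F) m th).2.
  exact: ((filtration_chain (@subf_refl F) (@subf_trans F) E
    (models_self F)).2 c).
exists k, fil; split=> // i /filP [ff sF]; split=> //.
exact: le_simple_artinian.
Qed.

(** * Iterated differences *)

Section Differences.
Variables (M N : zmodType).
Implicit Types (f g : M -> N) (h : M) (D : M -> Prop) (Ds : seq (M -> Prop)).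

Definition diff h f : M -> N := fun x => f (x + h) - f x.

(** All iterated differences of f, along one direction from each class in Ds,
    vanish. When Ds is nseq d.+1 D this says that f has degree at most d in the
    directions D. *)
Fixpoint van Ds f : Prop :=
  if Ds is D :: Ds' then forall h, D h -> van Ds' (diff h f)
  else forall x, f x = 0.

Lemma van_ext Ds f g : f =1 g -> van Ds f -> van Ds g.
Proof. by move=> /funext ->. Qed.

Lemma diffC h1 h2 f : diff h1 (diff h2 f) = diff h2 (diff h1 f).
Proof.
by apply/funext => x; rewrite /diff (addrAC x h1 h2) !opprD !opprK addrACA.
Qed.

Lemma van0 Ds : van Ds (fun _ => 0).
Proof.
elim: Ds => //= D Ds IH h _; apply: van_ext IH => x.
by rewrite /diff subrr.
Qed.

Lemma vanD Ds f g : van Ds f -> van Ds g -> van Ds (fun x => f x + g x).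
Proof.
elim: Ds f g => [|D Ds IH] f g /= vf vg; first by move=> x; rewrite vf vg addr0.
move=> h Dh; apply: van_ext (IH _ _ (vf h Dh) (vg h Dh)) => x.
by rewrite /diff opprD addrACA.
Qed.

Lemma vanN Ds f : van Ds f -> van Ds (fun x => - f x).
Proof.
elim: Ds f => [|D Ds IH] f /= vf; first by move=> x; rewrite vf oppr0.
move=> h Dh; apply: van_ext (IH _ (vf h Dh)) => x.
by rewrite /diff opprD.
Qed.

Lemma vanB Ds f g : van Ds f -> van Ds g -> van Ds (fun x => f x - g x).
Proof. by move=> vf /vanN; apply: vanD. Qed.

Lemma van_sum (I : Type) (r : seq I) (P : pred I) Ds (F : I -> M -> N) :
  (forall i, P i -> van Ds (F i)) -> van Ds (fun x => \sum_(i <- r | P i) F i x).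
Proof.
move=> vF; elim: r => [|i r IH].
  by apply: van_ext (van0 Ds) => x; rewrite big_nil.
case Pi: (P i); last by apply: van_ext IH => x; rewrite big_cons Pi.
by apply: van_ext (vanD (vF i Pi) IH) => x; rewrite big_cons Pi.
Qed.

Lemma van_shift Ds f a : van Ds f -> van Ds (fun x => f (x + a)).
Proof.
elim: Ds f => [|D Ds IH] f /= vf; first by move=> x; rewrite vf.
move=> h Dh; apply: van_ext (IH _ (vf h Dh)) => x.
by rewrite /diff addrAC.
Qed.

Lemma van_diff Ds f h : van Ds f -> van Ds (diff h f).
Proof. by move=> vf; exact: (vanB (van_shift h vf) vf). Qed.

Lemma van_cons D Ds f : van Ds f -> van (D :: Ds) f.
Proof. by move=> vf h _; apply: van_diff. Qed.

Lemma van_catl Ds Ds' f : van Ds f -> van (Ds' ++ Ds) f.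
Proof. by move=> vf; elim: Ds' => //= D Ds' IH; apply: van_cons. Qed.

Lemma van_catr Ds Ds' f : van Ds f -> van (Ds ++ Ds') f.
Proof.
elim: Ds f => [|D Ds IH] f /= vf; last by move=> h Dh; apply/IH/vf.
by apply: van_ext (van0 Ds') => x; rewrite vf.
Qed.

Lemma van_mono d d' D f : (d <= d')%N -> van (nseq d D) f -> van (nseq d' D) f.
Proof. by move=> /subnK <-; rewrite nseqD; apply: van_catl. Qed.

Lemma diffD h1 h2 f x : diff (h1 + h2) f x = diff h1 f (x + h2) + diff h2 f x.
Proof. by rewrite /diff [RHS]addrA subrK -addrA (addrC h2). Qed.

(** Degrees add when two sets of directions are added, because a difference along
    a + b is the sum of a translated difference along a and one along b. *)
Lemma van_add_dir (A B C : M -> Prop) d e f :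
  (forall h, C h -> exists a b, [/\ A a, B b & h = a + b]) ->
  van (nseq d.+1 A) f -> van (nseq e.+1 B) f -> van (nseq (d + e).+1 C) f.
Proof.
move=> CAB.
suff H n : forall d e f, (d + e)%N = n -> van (nseq d.+1 A) f ->
    van (nseq e.+1 B) f -> van (nseq (d + e).+1 C) f by apply: (H (d + e)%N).
elim: n {d e f} => [|n IH] d e f den vA vB.
  move/eqP: den; rewrite addn_eq0 => /andP[/eqP d0 /eqP e0]; subst d e.
  move=> h /CAB [a [b [Aa Bb ->]]] /= x.
  by rewrite diffD (vA a Aa) (vB b Bb) addr0.
have {}den : (d + e)%N = n.+1 := den.
rewrite den /= => h /CAB [a [b [Aa Bb ->]]]; rewrite -/(nseq n.+1 C).
have PA : van (nseq n.+1 C) (diff a f).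
  case: d den vA => [|d] den vA.
    have -> : diff a f = fun _ => 0 by apply/funext => x; apply: (vA a Aa).
    exact: van0.
  have <- : (d + e)%N = n by case: den.
  apply: IH; [by case: den| exact: (vA a Aa)| exact: van_diff].
have PB : van (nseq n.+1 C) (diff b f).
  case: e den vB => [|e] den vB.
    have -> : diff b f = fun _ => 0 by apply/funext => x; apply: (vB b Bb).
    exact: van0.
  have en : (d + e)%N = n by move: den; rewrite addnS => -[].
  rewrite -en; apply: IH => //; [exact: van_diff | exact: (vB b Bb)].
apply: van_ext (vanD (van_shift b PA) PB) => x.
by rewrite diffD.
Qed.

(** A vanishing product of differences along the V v survives a change of each
    direction by an element of Z, if f has degree less than e along Z: every
    difference along A v is a translated difference along V v up to one along Z,
    so in a product of e copies of the list either one whole copy consists of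
    differences along the V v, or at least e factors are taken along Z. *)
Lemma van_perturb (I : eqType) (vs : seq I) (A V : I -> M -> Prop)
  (Z : M -> Prop) e f :
  (forall v a, v \in vs -> A v a -> exists b z, [/\ V v b, Z z & a = b + z]) ->
  van (map V vs) f -> van (nseq e Z) f -> van (flatten (nseq e (map A vs))) f.
Proof.
move=> AV; elim: e f => //= e IH f vV vZ.
suff H ws g : {subset ws <= vs} -> van (map V ws) g -> van (map V vs) g ->
    van (nseq e.+1 Z) g -> van (map A ws ++ flatten (nseq e (map A vs))) g.
  exact: (H vs).
elim: ws g => [|w ws IHw] g.
  by move=> _ g0 _ _; apply: van_ext (van0 _) => x; rewrite g0.
move=> wsvs vW vV' vZ' a Aa.
have wvs : w \in vs by apply: wsvs; rewrite inE eqxx.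
have [b [z [Vb Zz ->]]] := AV w a wvs Aa.
have P1 : van (map A ws ++ flatten (nseq e (map A vs))) (diff b g).
  apply: IHw (vW b Vb) (van_diff _ vV') (van_diff _ vZ').
  by move=> x xws; apply: wsvs; rewrite inE xws orbT.
have P2 : van (map A ws ++ flatten (nseq e (map A vs))) (diff z g).
  by apply/van_catl/IH; [exact: van_diff | exact: vZ'].
apply: van_ext (vanD (van_shift z P1) P2) => x.
by rewrite diffD.
Qed.

(** A function of degree less than e is determined, at a sum of vectors, by its
    values at the partial sums of less than e of them. *)
Lemma van_sublists e f (hs : seq M) : van (nseq e (fun _ => True)) f ->
  (forall hs', subseq hs' hs -> (size hs' < e)%N -> f (\sum_(h <- hs') h) = 0) ->
  f (\sum_(h <- hs) h) = 0.
Proof.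
elim: hs e f => [|h hs IH] [|e] f vf f0; try exact: vf.
  exact: (f0 [::]).
have -> : f (\sum_(i <- h :: hs) i) =
    diff h f (\sum_(i <- hs) i) + f (\sum_(i <- hs) i).
  by rewrite big_cons addrC /diff subrK.
rewrite (IH e.+1 f) // ?addr0; last first.
  by move=> hs' sub sz; apply: f0 => //; apply: subseq_trans sub (subseq_cons _ _).
apply: IH (vf h I) _ => hs' sub sz.
have f1 : f (\sum_(i <- hs') i) = 0.
  apply: f0; last exact: leqW.
  exact: subseq_trans sub (subseq_cons _ _).
rewrite /diff f1 subr0 addrC -(big_cons _ _ h hs' xpredT id).
by apply: f0; rewrite /= ?eqxx.
Qed.

(** Directions along which f is invariant cost no degree. *)
Lemma van_invar (A B C : M -> Prop) d f :
  (forall h, C h -> exists a b, [/\ A a, B b & h = a + b]) ->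
  van (nseq d A) f -> van [:: B] f -> van (nseq d C) f.
Proof.
case: d => //= d CAB vA vB.
by have := van_add_dir CAB (d := d) (e := 0) vA vB; rewrite addn0.
Qed.

End Differences.

Lemma van_comp_map (M M' N : zmodType) (L : M' -> M) (f : M -> N)
  (I : eqType) (ws : seq I) (D : I -> M -> Prop) (D' : I -> M' -> Prop) (x0 : M) :
  {morph L : x y / x + y} ->
  (forall w h, w \in ws -> D' w h -> D w (L h)) ->
  van (map D ws) f -> van (map D' ws) (fun x => f (x0 + L x)).
Proof.
move=> LD DD'; elim: ws f DD' => [|w ws IH] f DD' //= vf h D'h.
apply: van_ext (IH _ _ (vf (L h) (DD' w h _ D'h))) => [x|w' h' w'ws|].
- by rewrite /diff LD addrA.
- by apply: DD'; rewrite inE w'ws orbT.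
- by rewrite inE eqxx.
Qed.

Lemma van_comp_nseq (M M' N : zmodType) (L : M' -> M) (f : M -> N)
  (D : M -> Prop) (D' : M' -> Prop) (x0 : M) d :
  {morph L : x y / x + y} -> (forall h, D' h -> D (L h)) ->
  van (nseq d D) f -> van (nseq d D') (fun x => f (x0 + L x)).
Proof.
move=> LD DD'; elim: d f => [|d IH] f //= vf h D'h.
apply: van_ext (IH _ (vf (L h) (DD' h D'h))) => x.
by rewrite /diff LD addrA.
Qed.

Lemma van_mul (M : zmodType) (R : comNzRingType) (f g : M -> R) (D : M -> Prop) d e :
  van (nseq d.+1 D) f -> van (nseq e.+1 D) g ->
  van (nseq (d + e).+1 D) (fun x => f x * g x : R).
Proof.
suff H n : forall d e (f g : M -> R), (d + e)%N = n ->
    van (nseq d.+1 D) f ->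
    van (nseq e.+1 D) g -> van (nseq (d + e).+1 D) (fun x => f x * g x : R).
  by apply: (H (d + e)%N).
elim: n {d e f g} => [|n IH] d e f g den vf vg.
  move/eqP: den; rewrite addn_eq0 => /andP[/eqP d0 /eqP e0]; subst d e.
  move=> h Dh /= x; have /= /eqP := vf h Dh x; have /= /eqP := vg h Dh x.
  by rewrite /diff !subr_eq0 => /eqP -> /eqP ->; rewrite subrr.
rewrite den /= => h Dh; rewrite -/(nseq n.+1 D).
have P1 : van (nseq n.+1 D) (fun x => diff h f x * g (x + h) : R).
  case: d den vf => [|d] den vf.
    apply: (van_ext (f := fun _ : M => 0 : R)); last exact: van0.
    move=> x /=.
    by have /= -> := vf h Dh x; rewrite mul0r.
  have <- : (d + e)%N = n by case: den.
  apply: IH; [by case: den| exact: (vf h Dh)| exact: van_shift].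
have P2 : van (nseq n.+1 D) (fun x => f x * diff h g x : R).
  case: e den vg => [|e] den vg.
    apply: (van_ext (f := fun _ : M => 0 : R)); last exact: van0.
    move=> x /=.
    by have /= -> := vg h Dh x; rewrite mulr0.
  have en : (d + e)%N = n by move: den; rewrite addnS => -[].
  rewrite -en; apply: IH => //; exact: (vg h Dh).
apply: van_ext (vanD P1 P2) => x.
by rewrite /diff mulrBl mulrBr addrA subrK.
Qed.

(** Vanishing along directions in the image of L may be tested on the cosets of
    that image. *)
Lemma van_fiber (M M' N : zmodType) (L : M' -> M) (f : M -> N)
  (D : M -> Prop) (D' : M' -> Prop) d :
  {morph L : x y / x + y} ->
  (forall h, D h -> exists2 h', D' h' & h = L h') ->
  (forall x, van (nseq d D') (fun y => f (x + L y))) -> van (nseq d D) f.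
Proof.
move=> LD DD'; elim: d f => [|d IH] f /= vf.
  have L0 : L 0 = 0 by apply: (addrI (L 0)); rewrite -LD !addr0.
  by move=> x; have := vf x 0; rewrite L0 addr0.
move=> h /DD' [h' D'h' ->]; apply: IH => x.
by apply: van_ext (vf x h' D'h') => y; rewrite /diff LD addrA.
Qed.

Lemma van_ffun (M N : zmodType) (Z : finType) (f : M -> {ffun Z -> N})
  (Ds : seq (M -> Prop)) :
  (forall z, van Ds (fun x => f x z)) <-> van Ds f.
Proof.
elim: Ds f => [|D Ds IH] f /=.
  split=> [f0 x|f0 z x]; last by rewrite f0 ffunE.
  by apply/ffunP => z; rewrite f0 ffunE.
split=> [vf h Dh|vf z h Dh].
  by apply/IH => z; apply: van_ext (vf z h Dh) => x; rewrite /diff !ffunE.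
by have /IH/(_ z) := vf h Dh; apply: van_ext => x; rewrite /diff !ffunE.
Qed.

(** * Subfunctors of the functors of functions on matrices *)

Lemma F2_addxx (a : 'F_2) : a + a = 0.
Proof. by case: (F2_cases a) => ->; apply: val_inj. Qed.

Lemma eventually_forall (T : finType) (Q : nat -> T -> Prop) :
  (forall t, exists N, forall i, (N <= i)%N -> Q i t) ->
  exists N, forall i, (N <= i)%N -> forall t, Q i t.
Proof.
move=> /choice [b bP]; exists (\max_t b t) => i bi t.
by apply: bP; apply: leq_trans bi; apply: leq_bigmax.
Qed.

Lemma monotone_stable (T : finType) (P : nat -> T -> Prop) :
  (forall i t, P i t -> P i.+1 t) ->
  exists N, forall i, (N <= i)%N -> forall t, P i t -> P N t.
Proof.
move=> mP.
have up i j t : (i <= j)%N -> P i t -> P j t.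
  by move=> /subnK <-; elim: (j - i)%N => // k IH /IH; rewrite addSn; apply: mP.
have [t|N NP] := @eventually_forall T (fun i t => forall j, P j t -> P i t).
  case: (pselect (exists j, P j t)) => [[j Pj]|no]; last first.
    by exists 0%N => i _ j Pj; case: no; exists j.
  by exists j => i ji _ _; apply: up Pj.
by exists N => i _ t; apply: NP.
Qed.

Lemma antitone_stable (T : finType) (P : nat -> T -> Prop) :
  (forall i t, P i.+1 t -> P i t) ->
  exists N, forall i, (N <= i)%N -> forall t, P N t -> P i t.
Proof.
move=> mP.
have [|N NP] := @monotone_stable T (fun i t => ~ P i t).
  by move=> i t nP /mP.
exists N => i Ni t PN; apply: contrapT => nP.
exact: NP Ni t nP PN.
Qed.

(** Duality for the finite-dimensional space of functions on T. *)
Lemma separate (T : finType) (P : {ffun T -> 'F_2} -> Prop) (u : {ffun T -> 'F_2}) :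
  P 0 -> (forall v w, P v -> P w -> P (v + w)) -> ~ P u ->
  exists n : T -> 'F_2,
    (forall v, P v -> \sum_t n t * v t = 0) /\ \sum_t n t * u t != 0.
Proof.
move=> P0 PD nPu.
pose S := [set v : {ffun T -> 'F_2} | `[< P v >]].
pose vec (v : {ffun T -> 'F_2}) := \row_(j < #|T|) v (enum_val j).
pose A := \matrix_(i < #|S|) vec (enum_val i).
have pairing (n : 'cV['F_2]_#|T|) (v : {ffun T -> 'F_2}) :
    \sum_t n (enum_rank t) 0 * v t = (vec v *m n) 0 0.
  rewrite mxE (reindex (fun j : 'I_#|T| => enum_val j)) /=; last first.
    by apply: onW_bij; apply: enum_val_bij.
  by apply: eq_bigr => j _; rewrite enum_valK mxE mulrC.
have memA (v : {ffun T -> 'F_2}) : P v -> (vec v <= A)%MS.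
  move=> Pv; have vS : v \in S by rewrite inE; apply/asboolP.
  have -> : vec v = row (enum_rank_in vS v) A.
    by rewrite rowK enum_rankK_in.
  exact: row_sub.
have nuA : ~~ (vec u <= A)%MS.
  apply/negP => /submxP [D uDA]; apply: nPu.
  have -> : u = \sum_(i | D 0 i != 0) (enum_val i : {ffun T -> 'F_2}).
    apply/ffunP => t; rewrite sum_ffunE.
    move/rowP: uDA => /(_ (enum_rank t)); rewrite !mxE enum_rankK => ->.
    rewrite [RHS]big_mkcond; apply: eq_bigr => i _; rewrite !mxE enum_rankK.
    by case: (F2_cases (D 0 i)) => ->; rewrite ?mul0r ?mul1r ?eqxx ?oner_neq0.
  apply: (big_ind P) => // i _.
  by have := enum_valP i; rewrite inE => /asboolP.
have [j nj] : exists j, (vec u *m cokermx A) 0 j != 0.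
  apply: contrapT => no; move: nuA; rewrite submxE => /negP; apply.
  apply/eqP/rowP => j; rewrite [RHS]mxE; apply/eqP; apply: contrapT => nj.
  by apply: no; exists j; apply/negP.
have colE v : (vec v *m col j (cokermx A)) 0 0 = (vec v *m cokermx A) 0 j.
  by rewrite mxE [RHS]mxE; apply: eq_bigr => i _; congr (_ * _); rewrite mxE.
exists (fun t => col j (cokermx A) (enum_rank t) 0); split.
  move=> v /memA; rewrite submxE => /eqP vA.
  by rewrite (pairing (col j (cokermx A))) colE vA mxE.
by rewrite (pairing (col j (cokermx A))) colE.
Qed.

Notation Fun k s := {ffun 'M['F_2]_(k, s) -> 'F_2}.

Lemma Fun_addxx k s (u : Fun k s) : u + u = 0.
Proof. by apply/ffunP => b; rewrite !ffunE F2_addxx. Qed.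

Lemma Fun_addK k s (u v : Fun k s) : u + v + v = u.
Proof. by rewrite -addrA Fun_addxx addr0. Qed.

(** The action of a linear map 'rV_k -> 'rV_k' on functions of s linear forms:
    its transpose multiplies the matrix of the forms on the left. *)
Definition push k k' s (A : 'M['F_2]_(k, k')) (u : Fun k s) : Fun k' s :=
  [ffun b => u (A *m b)].

(** Right multiplication commutes with [push], so the combinations of right
    multiplications are natural; every natural map between these functors has this
    form. *)
Definition pull s s' (c : {ffun 'M['F_2]_(s', s) -> 'F_2}) k (u : Fun k s) :
  Fun k s' := [ffun b : 'M_(k, s') => \sum_B c B * u (b *m B)].

Lemma pull0 s s' (c : {ffun 'M['F_2]_(s', s) -> 'F_2}) k : pull c (0 : Fun k s) = 0.
Proof.
by apply/ffunP => b; rewrite !ffunE big1 // => B _; rewrite !ffunE mulr0.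
Qed.

Lemma pullD s s' (c : {ffun 'M['F_2]_(s', s) -> 'F_2}) k (u v : Fun k s) :
  pull c (u + v) = pull c u + pull c v.
Proof.
apply/ffunP => b; rewrite !ffunE -big_split /=; apply: eq_bigr => B _.
by rewrite !ffunE mulrDr.
Qed.

Lemma pull_push s s' (c : {ffun 'M['F_2]_(s', s) -> 'F_2}) k k'
  (A : 'M_(k, k')) (u : Fun k s) : pull c (push A u) = push A (pull c u).
Proof.
apply/ffunP => b; rewrite !ffunE; apply: eq_bigr => B _.
by rewrite !ffunE mulmxA.
Qed.

Lemma pushD k k' s (A : 'M_(k, k')) (u v : Fun k s) :
  push A (u + v) = push A u + push A v.
Proof. by apply/ffunP => b; rewrite !ffunE. Qed.

Lemma push0 k k' s (A : 'M_(k, k')) : push A (0 : Fun k s) = 0.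
Proof. by apply/ffunP => b; rewrite !ffunE. Qed.

(** A subfunctor of the functor k |-> Fun k s. *)
Record fam (s : nat) := Fam {
  fmem :> forall k, Fun k s -> Prop;
  fmem0 : forall k, fmem (0 : Fun k s);
  fmemD : forall k (u v : Fun k s), fmem u -> fmem v -> fmem (u + v);
  fmem_push : forall k k' (A : 'M_(k, k')) (u : Fun k s),
    fmem u -> fmem (push A u) }.

Arguments fmem {s} f k u : rename.

Section Families.
Variable s : nat.
Implicit Types (G H : fam s).

Definition fle G H := forall k u, G k u -> H k u.

Lemma fle_refl G : fle G G. Proof. by []. Qed.

Lemma fle_trans G H K : fle G H -> fle H K -> fle G K.
Proof. by move=> GH HK k u /GH /HK. Qed.

Definition fzero : fam s.
Proof.
apply: (@Fam s (fun k u => u = 0)) => //.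
- by move=> k u v -> ->; rewrite addr0.
- by move=> k k' A u ->; rewrite push0.
Defined.

Lemma fzero_le G : fle fzero G.
Proof. by move=> k u ->; apply: fmem0. Qed.

Definition fcap G H : fam s.
Proof.
apply: (@Fam s (fun k u => G k u /\ H k u)) => //.
- by move=> k; split; apply: fmem0.
- by move=> k u v [? ?] [? ?]; split; apply: fmemD.
- by move=> k k' A u [? ?]; split; apply: fmem_push.
Defined.

Definition fbigcap (t : nat -> fam s) : fam s.
Proof.
apply: (@Fam s (fun k u => forall i, t i k u)) => //.
- by move=> k i; apply: fmem0.
- by move=> k u v tu tv i; apply: fmemD.
- by move=> k k' A u tu i; apply: fmem_push.
Defined.

Definition fadd G H : fam s.
Proof.
apply: (@Fam s (fun k u => exists v w, [/\ G k v, H k w & u = v + w])) => //.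
- by move=> k; exists 0, 0; split; rewrite ?addr0 //; apply: fmem0.
- move=> k u u' [v [w [Gv Hw ->]]] [v' [w' [Gv' Hw' ->]]].
  by exists (v + v'), (w + w'); split; rewrite 1?addrACA //; apply: fmemD.
- move=> k k' A u [v [w [Gv Hw ->]]]; exists (push A v), (push A w).
  by rewrite pushD; split => //; apply: fmem_push.
Defined.

Definition fker s' (c : {ffun 'M['F_2]_(s', s) -> 'F_2}) : fam s.
Proof.
apply: (@Fam s (fun k u => pull c u = 0)).
- by move=> k; apply: pull0.
- by move=> k u v cu cv; rewrite pullD cu cv addr0.
- by move=> k k' A u cu; rewrite pull_push cu push0.
Defined.

(** Directions are given by row spaces, which are stable under the left
    multiplications of [push]. *)
Definition dir k (B : 'M['F_2]_s) (h : 'M['F_2]_(k, s)) : Prop := (h <= B)%MS.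

Definition vfam (Bs : seq 'M['F_2]_s) : fam s.
Proof.
apply: (@Fam s (fun k u => van (map (@dir k) Bs) u)).
- move=> k; apply: (van_ext (f := fun _ => 0)); last exact: van0.
  by move=> b; rewrite ffunE.
- by move=> k u v vu vv; apply: van_ext (vanD vu vv) => b; rewrite ffunE.
- move=> k k' A u vu.
  have LD : {morph mulmx A : x y / (x : 'M_(k', s)) + y >-> x + y}.
    by move=> x y; rewrite mulmxDr.
  have vA := @van_comp_map _ _ _ _ _ _ Bs (@dir k) (@dir k') 0 LD _ vu.
  apply: van_ext (vA _) => [b|w h _ hw]; first by rewrite ffunE add0r.
  exact: submx_trans (submxMl _ _) hw.
Defined.

End Families.

Definition fimg s s' (c : {ffun 'M['F_2]_(s', s) -> 'F_2}) (G : fam s) : fam s'.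
Proof.
apply: (@Fam s' (fun k u => exists2 v, G k v & u = pull c v)) => //.
- by move=> k; exists 0; rewrite ?pull0 //; apply: fmem0.
- move=> k _ _ [u Gu ->] [v Gv ->]; exists (u + v); rewrite ?pullD //.
  exact: fmemD.
- move=> k k' A _ [u Gu ->]; exists (push A u); rewrite ?pull_push //.
  exact: fmem_push.
Defined.

Notation fkrull n a b := (krull (@fle _) n a b).

(** The interval is cut into its image under the operator c and its part in the
    kernel of c. *)
Lemma krull_pull s s' (c : {ffun 'M['F_2]_(s', s) -> 'F_2}) n (a b : fam s)
  (t : fam s') : fle a b -> (forall k u, b k u -> t k (pull c u)) ->
  fkrull n (fzero s') t -> fkrull n (fcap a (fker c)) (fcap b (fker c)) -> fkrull n a b.
Proof.
move=> ab bt kt kk.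
pose th (G : fam s) := (fimg c G, fcap G (fker c)).
apply: (krull_transfer (@fle_refl s) (@fle_trans s)
  (le2 := le_prod (@fle s') (@fle s)) (th := th)) => //.
- move=> x y xab yab xy; split.
    split=> k u /=; first by move=> [v /xy yv ->]; exists v.
    by move=> [/xy].
  move=> [imyx keryx] k u yu.
  have [|v xv uv] := imyx k (pull c u); first by exists u.
  have yuv : fcap y (fker c) k (u + v).
    split; first by apply: fmemD (xy _ _ xv).
    by rewrite /= pullD -uv Fun_addxx.
  have [xuv _] := keryx _ _ yuv.
  by rewrite -(Fun_addK u v); apply: fmemD.
apply: (krull_prod (@fle_refl s') (@fle_refl s) (@fle_trans s') (@fle_trans s)) => //=.
apply: (krull_between (@fle_refl s') (@fle_trans s') kt); first exact: fzero_le.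
by move=> k u /= [v /bt tv ->].
Qed.

(** The same for finitely many operators, with the joint kernel left as a
    hypothesis. *)
Lemma krull_joint s s' (cs : seq {ffun 'M['F_2]_(s', s) -> 'F_2}) n (a b : fam s) :
  fle a b ->
  (forall c, c \in cs -> exists2 t : fam s',
     (forall k u, b k u -> t k (pull c u)) & fkrull n (fzero s') t) ->
  (forall a' b' : fam s, fle a' b' -> fle b' b ->
     (forall k u, b' k u -> a k u -> a' k u) ->
     (forall k u c, b' k u -> c \in cs -> pull c u = 0) -> fkrull n a' b') ->
  fkrull n a b.
Proof.
elim: cs a b => [|c cs IH] a b ab tP kP; first exact: kP.
have [t bt kt] := tP c (mem_head _ _).
apply: (krull_pull ab bt kt); apply: IH => [k u [au cu]|c' c'cs|a' b' a'b' b'b aa' cs0].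
- by split=> //; apply: ab.
- have [|t' bt' kt'] := tP c'; first by rewrite inE c'cs orbT.
  by exists t' => // k u [bu _]; apply: bt'.
apply: kP => //.
- by move=> k u /b'b [].
- move=> k u b'u au; apply: (aa' k u b'u); split=> //.
  by case: (b'b _ _ b'u).
- move=> k u c' b'u; rewrite inE => /orP[/eqP->|]; last exact: cs0 b'u.
  by case: (b'b _ _ b'u).
Qed.

(** By the modular law, x |-> (x & a, (x + a) & b) is strictly monotone below
    a + b. *)
Lemma krull_fadd s n (a b : fam s) :
  fkrull n (fzero s) a -> fkrull n (fzero s) b -> fkrull n (fzero s) (fadd a b).
Proof.
move=> ka kb.
pose th (G : fam s) := (fcap G a, fcap (fadd G a) b).
have mono x y : fle x y -> le_prod (@fle s) (@fle s) (th x) (th y).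
  move=> xy; split=> k u /=; first by move=> [/xy].
  by move=> [[v [w [/xy yv aw ->]]] bu]; split=> //; exists v, w.
apply: (krull_transfer (@fle_refl s) (@fle_trans s)
  (le2 := le_prod (@fle s) (@fle s)) (th := th)) => //.
- exact: fzero_le.
- move=> x y xab yab xy; split; first exact: mono.
  move=> [yax yabx] k u yu.
  have [v [w [av bw uvw]]] := yab.2 _ _ yu.
  have [[x1 [a1 [xx1 aa1 wxa]]] _] : fcap (fadd x a) b k w.
    apply: yabx; split=> //; exists u, v; split=> //.
    by rewrite uvw (addrC v) Fun_addK.
  have ux1 : x k (u + x1).
    apply: (yax k _ _).1; split; first by apply: fmemD (xy _ _ xx1).
    have -> : u + x1 = v + a1.
      by rewrite uvw wxa (addrC x1) addrA Fun_addK.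
    exact: fmemD.
  by rewrite -(Fun_addK u x1); apply: fmemD.
apply: (krull_prod (@fle_refl s) (@fle_refl s) (@fle_trans s) (@fle_trans s)) => /=.
  apply: (krull_between (@fle_refl s) (@fle_trans s) ka); first exact: fzero_le.
  by move=> k u [].
apply: (krull_between (@fle_refl s) (@fle_trans s) kb); first exact: fzero_le.
by move=> k u [].
Qed.

(** * The leading operators of a subfunctor *)

(** Spans the directions supported in the last r columns. *)
Definition tail_dirs m r : 'M['F_2]_(m + r) := <<row_mx (0 : 'M_(r, m)) 1%:M>>%MS.

(** Spans the directions l *m w in the first m columns, with l a column. *)
Definition head_dirs m r (w : 'rV['F_2]_m) : 'M['F_2]_(m + r) :=
  <<row_mx w (0 : 'rV_r)>>%MS.

Lemma tail_dirsE m r k :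
  @dir (m + r) k (tail_dirs m r) = (fun h : 'M_(k, m + r) => lsubmx h = 0).
Proof.
apply/funext => h; apply/propext; rewrite /dir genmxE.
split=> [/submxP [D ->]|h0]; first by rewrite mul_mx_row row_mxKl mulmx0.
apply/submxP; exists (rsubmx h).
by rewrite mul_mx_row mulmx0 mulmx1 -h0 hsubmxK.
Qed.

Definition along m r k (w : 'rV['F_2]_m) (h : 'M['F_2]_(k, m + r)) : Prop :=
  exists l : 'cV_k, h = row_mx (l *m w) 0.

Lemma head_dirsE m r k w : @dir (m + r) k (head_dirs r w) = @along m r k w.
Proof.
apply/funext => h; apply/propext; rewrite /dir genmxE.
split=> [/submxP [D ->]|[l ->]].
  by exists D; rewrite mul_mx_row mulmx0.
by apply/submxP; exists l; rewrite mul_mx_row mulmx0.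
Qed.

(** The functions of degree less than e in the last r columns. *)
Definition polyfam m r e : fam (m + r) := vfam (nseq e (tail_dirs m r)).

(** The functions that are moreover killed by the products of one difference along
    each vector of ws in the first m columns. *)
Definition dirfam m r e (ws : seq 'rV['F_2]_m) : fam (m + r) :=
  fcap (polyfam m r e) (vfam (map (@head_dirs m r) ws)).

Lemma polyfamE m r e k (u : Fun k (m + r)) :
  polyfam m r e k u = van (nseq e (fun h : 'M_(k, m + r) => lsubmx h = 0)) u.
Proof. by rewrite /= map_nseq tail_dirsE. Qed.

Lemma dirfamE m r e ws k (u : Fun k (m + r)) :
  dirfam r e ws k u = (polyfam m r e k u /\ van (map (@along m r k) ws) u).
Proof.
congr (_ /\ _); rewrite /= -map_comp; congr (van _ _).
by apply: eq_map => w /=; rewrite head_dirsE.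
Qed.

Section Step.
Variables m r e : nat.

Lemma ker_full_rank k (a a0 : 'M['F_2]_(k, m)) : \rank a0 = m ->
  (forall v : 'rV_k, v *m a = 0 -> v *m a0 = 0) ->
  forall v : 'rV_k, v *m a0 = 0 -> v *m a = 0.
Proof.
move=> ra0 aa0 v /eqP; rewrite -sub_kermx => va0; apply/eqP.
have sub : (kermx a <= kermx a0)%MS.
  apply/row_subP => i; apply/sub_kermxP/aa0/sub_kermxP; exact: row_sub.
rewrite -sub_kermx; apply: submx_trans va0 _.
rewrite -(mxrank_leqif_sup sub) eqn_leq (mxrankS sub) !mxrank_ker ra0.
by rewrite leq_sub2l // rank_leq_col.
Qed.

Lemma factor_rank d k l (A : 'M['F_2]_(k, l)) : (\rank A <= d)%N ->
  exists (q : 'M_(k, d)) (j : 'M_(d, l)), A = q *m j.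
Proof.
move=> rA; exists (col_ebase A *m pid_mx (\rank A)).
exists (pid_mx (\rank A) *m row_ebase A).
rewrite !mulmxA -(mulmxA (col_ebase A)) pid_mx_id //.
by rewrite mulmx_ebase.
Qed.

(** The identity is a sum of k matrices of rank one, and [van_sublists] leaves less
    than e of them. *)
Lemma nonzero_low_rank k (f : 'M['F_2]_k -> 'F_2) :
  van (nseq e (fun _ => True)) f -> f 1%:M != 0 ->
  exists (q : 'M_(k, e)) (j : 'M_(e, k)), f (q *m j) != 0.
Proof.
move=> vf; apply: contraPP => nf; apply/negP; rewrite negbK; apply/eqP.
have -> : 1%:M = \sum_(h <- [seq delta_mx i i | i <- enum 'I_k]) h :> 'M['F_2]_k.
  rewrite big_map big_enum /=; apply/matrixP => i j.
  rewrite summxE (bigD1 i) //= big1 => [|l li]; rewrite !mxE ?eqxx ?addr0 //=.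
    by rewrite (eq_sym j); case: (i == j).
  by rewrite eq_sym (negPf li).
apply: van_sublists vf _ => hs sub sz.
have [|q [j ->]] := @factor_rank e k k (\sum_(h <- hs) h).
  apply: leq_trans (ltnW sz).
  have : forall h, h \in hs -> (\rank h <= 1)%N.
    by move=> h /(mem_subseq sub) /mapP [i _ ->]; rewrite mxrank_delta.
  elim: hs {sub sz} => [|h hs IH] hs1; first by rewrite big_nil mxrank0.
  rewrite big_cons; apply: leq_trans (mxrank_add _ _) _.
  rewrite /= -[(size hs).+1]add1n leq_add //.
    by apply: hs1; rewrite inE eqxx.
  by apply: IH => h' h'hs; apply: hs1; rewrite inE h'hs orbT.
apply/eqP; apply: contrapT => /negP nz; apply: nf.
by exists q, j.
Qed.

(** One block of a concatenation of direction lists is enough to kill f. *)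
Lemma van_block (M N : zmodType) (I J : eqType) (D : J -> M -> Prop) (v : I -> J)
  (il : seq I) i (f : M -> N) : i \in il -> van (nseq e (D (v i))) f ->
  van (map D (flatten [seq nseq e (v i) | i <- il])) f.
Proof.
elim: il => //= i' il IH; rewrite inE map_cat map_nseq => /orP[/eqP <-|iil] vf.
  exact: van_catr.
exact/van_catl/IH.
Qed.

(** The operators that detect G up to smaller dimension. They are taken from a
    finite set that does not depend on G, and this bounds the chains. *)
Definition leading (G : fam (m + r)) (c : {ffun 'M['F_2]_(m + e, m + r) -> 'F_2}) :
    Prop :=
  exists2 ws, all (fun w : 'rV['F_2]_m => w != 0) ws &
    forall k u, G k u -> dirfam e e ws k (pull c u).

(** If u were not in G, a linear form n orthogonal to G would not vanish at u. The
    terms of n are grouped by the kernel of their first m columns, and one group C,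
    with a kernel of codimension m, has a nonzero value at u. Differences along
    vectors that lie in the kernel of a term outside C but not in the common kernel
    of C leave only the group C, and turn it into a leading operator c of G. A
    choice of c by [nonzero_low_rank] does not kill u. *)
Lemma leading_inclusion (G : fam (m + r)) k (u : Fun k (m + r)) :
  fle G (polyfam m r e) -> polyfam m r e k u ->
  (forall c, leading G c -> pull c u = 0) ->
  (forall b : 'M_(k, m + r), (\rank (lsubmx b) < m)%N -> u b = 0) -> G k u.
Proof.
move=> GX uX cu0 u0; apply: contrapT => nGu.
have [n [nG nu]] := separate (@fmem0 _ G k) (@fmemD _ G k) nGu.
pose ker (b : 'M['F_2]_(k, m + r)) := [set v : 'rV_k | v *m lsubmx b == 0].
have [b0 [rb0 nC]] : exists b0, \rank (lsubmx b0) = m /\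
    \sum_(b | ker b == ker b0) n b * u b != 0.
  apply: contrapT => no; move/negP: nu; apply; apply/eqP.
  rewrite (partition_big ker predT) //= big1 // => K _.
  apply/eqP; apply: contrapT => /negP nK.
  case: (pselect (exists2 b0, ker b0 = K & u b0 != 0)) => [[b0 kb0 ub0]|nob].
    apply: no; exists b0; split; last by rewrite kb0.
    apply/eqP; rewrite eqn_leq rank_leq_col leqNgt.
    by apply/negP => /u0 ub00; rewrite ub00 eqxx in ub0.
  move/negP: nK; apply; apply/eqP; rewrite big1 // => b /eqP kb.
  case: (eqVneq (u b) 0) => [->|nub]; first by rewrite mulr0.
  by case: nob; exists b.
pose C b := ker b == ker b0.
pose a0 := lsubmx b0.
have [t ta0] : exists t : 'M_(m, k), t *m a0 = 1%:M.
  by exists (pinvmx a0); apply: mulVpmx; rewrite /row_full rb0.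
(* h *m a0 = 0 means that the rows of h lie in the common kernel of C *)
have kerC b k' (h : 'M_(k', k)) : C b -> h *m a0 = 0 -> h *m lsubmx b = 0.
  move=> /eqP Cb ha0; apply/row_matrixP => i; rewrite row0 row_mul.
  have : row i h \in ker b0 by rewrite inE -row_mul ha0 row0.
  by rewrite -Cb inE => /eqP.
(* a vector in the kernel of b and outside the common kernel of C *)
pose killer (b : 'M['F_2]_(k, m + r)) : 'rV_k :=
  if [pick v : 'rV_k | (v *m lsubmx b == 0) && (v *m a0 != 0)] is Some v
  then v else 0.
have killerP b : ~~ C b -> killer b *m lsubmx b = 0 /\ killer b *m a0 != 0.
  move=> nCb; rewrite /killer; case: pickP => [v /andP[/eqP ? ?] //|no].
  case/negP: nCb; have bb0 (v : 'rV_k) : v *m lsubmx b = 0 -> v *m a0 = 0.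
    move=> vb; apply/eqP; apply: contraFT (no v) => va0.
    by rewrite vb eqxx.
  apply/eqP/setP => v; rewrite !inE; apply/eqP/eqP; first exact: bb0.
  exact: ker_full_rank.
pose fC k' (v : Fun k' (m + r)) (x : 'M_(k', k)) := \sum_(b | C b) n b * v (x *m b).
(* each vector is used e times, to kill a term of degree less than e *)
pose vs := flatten [seq nseq e (killer b) | b <- enum [pred b | ~~ C b]].
have vsP v : v \in vs -> v *m a0 != 0.
  move=> /flattenP [l /mapP [b]]; rewrite mem_enum => nCb ->.
  by rewrite mem_nseq => /andP[_ /eqP ->]; case: (killerP b nCb).
pose V k' (v : 'rV_k) (h : 'M['F_2]_(k', k)) := (h <= v)%MS : Prop.
pose Z k' (h : 'M['F_2]_(k', k)) := h *m a0 = 0.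
have vanb k' (v : Fun k' (m + r)) b (D : 'M_(k', k) -> Prop) : polyfam m r e k' v ->
    (forall h, D h -> h *m lsubmx b = 0) ->
    van (nseq e D) (fun x : 'M_(k', k) => n b * v (x *m b)).
  rewrite polyfamE => vX Db.
  case: (F2_cases (n b)) => ->.
    apply: (van_ext (f := fun _ => 0)); last exact: van0.
    by move=> x; rewrite mul0r.
  have LD : {morph (fun x : 'M['F_2]_(k', k) => x *m b) : x y / x + y}.
    by move=> x y; rewrite mulmxDl.
  apply: van_ext (van_comp_nseq (D' := D) 0 LD _ vX) => [x|h Dh].
    by rewrite add0r mul1r.
  by rewrite -mulmx_lsub Db.
have vanZ k' (v : Fun k' (m + r)) : polyfam m r e k' v ->
    van (nseq e (@Z k')) (fC k' v).
  move=> vX; apply: van_sum => b Cb; apply: vanb => // h; exact: kerC.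
(* as n vanishes on G, the group C is minus the sum of the other terms *)
have vanV k' (v : Fun k' (m + r)) : G k' v -> van (map (@V k') vs) (fC k' v).
  move=> Gv.
  have E x : fC k' v x = - \sum_(b | ~~ C b) n b * v (x *m b).
    apply/eqP; rewrite -addr_eq0 -(bigID C xpredT (fun b => n b * v (x *m b))) /=.
    apply/eqP; rewrite -[RHS](nG _ (fmem_push x Gv)).
    by apply: eq_bigr => b _; rewrite ffunE.
  apply: (van_ext (f := fun x => - \sum_(b | ~~ C b) n b * v (x *m b))).
    by move=> x; rewrite E.
  apply/vanN/van_sum => b nCb.
  apply: (van_block (i := b)); first by rewrite mem_enum.
  apply: vanb; first exact: GX.
  move=> h /submxP [D ->]; rewrite -mulmxA.
  by case: (killerP b nCb) => ->; rewrite mulmx0.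
(* a0 *m t and rho split 'rV_k into a complement and the kernel of a0 *)
pose rho : 'M['F_2]_k := 1%:M - a0 *m t.
have rho_a0 : rho *m a0 = 0 by rewrite mulmxBl mul1mx -mulmxA ta0 mulmx1 subrr.
pose A k' (v : 'rV_k) (h : 'M['F_2]_(k', k)) :=
  exists l : 'cV_k', h = l *m (v *m a0 *m t).
(* each vector of vs is replaced by its component in the image of t *)
have vanA k' (v : Fun k' (m + r)) : G k' v ->
    van (flatten (nseq e (map (@A k') vs))) (fC k' v).
  move=> Gv; apply: van_perturb (vanV k' v Gv) (vanZ k' v (GX _ _ Gv)).
  move=> x _ _ [l ->]; exists (l *m x), (l *m (x *m a0 *m t) - l *m x).
  split; first exact: submxMl.
    by rewrite /Z mulmxBl -!mulmxA ta0 mulmx1 subrr.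
  by rewrite addrC subrK.
pose ws := flatten (nseq e [seq v *m a0 | v <- vs]).
(* the substitution by N j restricts the kernel directions to e of them *)
pose N j := col_mx t (j *m rho) : 'M['F_2]_(m + e, k).
pose c j : {ffun 'M['F_2]_(m + e, m + r) -> 'F_2} :=
  [ffun B => \sum_(b | C b && (N j *m b == B)) n b].
have pullc j k' (v : Fun k' (m + r)) x : pull (c j) v x = fC k' v (x *m N j).
  rewrite ffunE /fC [RHS](partition_big (fun b => N j *m b) predT) //=.
  apply: eq_bigr => B _; rewrite ffunE mulr_suml.
  by apply: eq_bigr => b /andP[_ /eqP <-]; rewrite mulmxA.
have leadc j : leading G (c j).
  exists ws.
    apply/allP => w /flattenP [l]; rewrite mem_nseq => /andP[_ /eqP ->].
    by move=> /mapP [v /vsP va0 ->].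
  move=> k' v Gv.
  have LD : {morph (fun x : 'M['F_2]_(k', m + e) => x *m N j) : x y / x + y}.
    by move=> x y; rewrite mulmxDl.
  rewrite dirfamE polyfamE; split.
    apply: van_ext (van_comp_nseq 0 LD _ (vanZ k' v (GX _ _ Gv))) => [x|h h0].
      by rewrite add0r pullc.
    by rewrite /Z -[h]hsubmxK h0 mul_row_col mul0mx add0r -!mulmxA rho_a0 !mulmx0.
  pose D (w : 'rV_m) (h : 'M['F_2]_(k', k)) := exists l : 'cV_k', h = l *m (w *m t).
  have vanD' : van (map D ws) (fC k' v).
    rewrite /ws map_flatten map_nseq -map_comp; exact: vanA.
  apply: van_ext (van_comp_map 0 LD _ vanD') => [x|w h _ [l ->]].
    by rewrite add0r pullc.
  by exists l; rewrite mul_row_col mul0mx addr0 mulmxA.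
pose f (x : 'M['F_2]_k) := fC k u (a0 *m t + x *m rho).
have vf : van (nseq e (fun _ => True)) f.
  have LD : {morph (fun x : 'M['F_2]_k => x *m rho) : x y / x + y}.
    by move=> x y; rewrite mulmxDl.
  apply: van_comp_nseq LD _ (vanZ k u uX) => h _.
  by rewrite /Z -mulmxA rho_a0 mulmx0.
have f1 : f 1%:M != 0.
  rewrite /f mul1mx /rho addrC subrK.
  by rewrite /fC; under eq_bigr do rewrite mul1mx.
have [q [j]] := nonzero_low_rank vf f1; apply/negP; rewrite negbK; apply/eqP.
have /ffunP /(_ (row_mx a0 q)) := cu0 (c j) (leadc j).
by rewrite pullc ffunE mul_row_col mulmxA.
Qed.

Definition delta_ffun s s' (B : 'M['F_2]_(s', s)) : {ffun 'M['F_2]_(s', s) -> 'F_2} :=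
  [ffun B' => (B' == B)%:R].

Lemma pull_delta s s' (B : 'M['F_2]_(s', s)) k (u : Fun k s) b :
  pull (delta_ffun B) u b = u (b *m B).
Proof.
rewrite ffunE (bigD1 B) //= big1 => [|B' B'B]; rewrite ffunE ?eqxx ?mul1r ?addr0 //.
by rewrite (negPf B'B) mul0r.
Qed.

Hypothesis krull_lower : (0 < m)%N -> fkrull m (fzero _) (polyfam m.-1 r e).
Hypothesis krull_directions : forall ws : seq 'rV['F_2]_m, all (fun w => w != 0) ws ->
  fkrull m (fzero _) (dirfam e e ws).

(** The leading operators of G map G into the functors of [krull_directions], the
    restrictions to matrices of the form q *m h with q of m - 1 columns map G into
    the functor of [krull_lower], and the joint kernel lies in G'. *)
Lemma krull_leading (G' G : fam (m + r)) : fle G' G -> fle G (polyfam m r e) ->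
  (forall k (u : Fun k (m + r)), polyfam m r e k u ->
     (forall c, leading G c -> pull c u = 0) ->
     (forall b : 'M_(k, m + r), (\rank (lsubmx b) < m)%N -> u b = 0) ->
     G' k u) ->
  fkrull m G' G.
Proof.
move=> G'G GX incl.
pose cs := [seq c <- enum {: {ffun 'M['F_2]_(m + e, m + r) -> 'F_2}} |
  `[< leading G c >]].
apply: (krull_joint (cs := cs) G'G) => [c|a b ab bG ba b0].
  rewrite mem_filter => /andP[/asboolP [ws wsn0 GK] _].
  by exists (dirfam e e ws) => //; apply: krull_directions.
have {}b0 k (u : Fun k (m + r)) c : b k u -> leading G c -> pull c u = 0.
  by move=> bu Lc; apply: b0 bu _; rewrite mem_filter mem_enum andbT; apply/asboolP.
have [m0|m_gt0] := posnP m.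
  apply: (krull_le (@fle_trans _)) => k u bu; apply: (ba _ _ bu); apply: incl.
  - exact/GX/bG.
  - by move=> c; apply: b0.
  - by move=> b1; rewrite [X in (_ < X)%N]m0.
pose B h : 'M['F_2]_(m.-1 + r, m + r) := block_mx h 0 0 1%:M.
pose hs := [seq delta_ffun (B h) | h <- enum {: 'M['F_2]_(m.-1, m)}].
apply: (krull_joint (cs := hs) ab) => [_ /mapP [h _ ->]|a' b' a'b' b'b ba' b'0].
  exists (polyfam m.-1 r e); last exact: krull_lower.
  move=> k u /bG/GX; rewrite !polyfamE => uX.
  have LD : {morph (fun x : 'M['F_2]_(k, m.-1 + r) => x *m B h) : x y / x + y}.
    by move=> x y; rewrite mulmxDl.
  apply: van_ext (van_comp_nseq 0 LD _ uX) => [x|x x0].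
    by rewrite pull_delta add0r.
  by rewrite -[x]hsubmxK x0 mul_row_block !mul0mx mulmx0 addr0 row_mxKl.
apply: (krull_le (@fle_trans _)) => k u b'u; apply: (ba' _ _ b'u).
apply: (ba _ _ (b'b _ _ b'u)); apply: incl.
- exact/GX/bG/b'b.
- by move=> c; apply/b0/b'b.
move=> b1 rb1; have [|q [h hE]] := @factor_rank m.-1 _ _ (lsubmx b1).
  by rewrite -ltnS (ltn_predK m_gt0).
have /ffunP /(_ (row_mx q (rsubmx b1))) : pull (delta_ffun (B h)) u = 0.
  by apply: b'0 b'u _; apply: map_f; rewrite mem_enum.
rewrite pull_delta ffunE mul_row_block !mulmx0 addr0 add0r mulmx1 -hE.
by rewrite hsubmxK.
Qed.

(** The sets of leading operators form a monotone sequence of subsets of a finite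
    set. When they are constant along a descending chain from N on,
    [leading_inclusion] applied to every member shows that [krull_leading] applies
    to the intersection of the chain and s N. *)
Theorem krull_step : fkrull m.+1 (fzero _) (polyfam m r e).
Proof.
split=> s sX ms.
  have le_s i j : (i <= j)%N -> fle (s j) (s i).
    exact: (descending (@fle_refl _) (@fle_trans _) ms).
  have smono i c : leading (s i) c -> leading (s i.+1) c.
    by move=> [ws ws0 sK]; exists ws => // k u /ms; apply: sK.
  have [N sN] := monotone_stable smono.
  have kN : fkrull m (fbigcap s) (s N).
    apply: krull_leading => [k u su|k u|k u uX u0 ru i]; first exact: su.
      exact: (sX N).2.
    pose j := maxn N i.
    suff : s j k u by apply: le_s; rewrite leq_maxr.
    apply: leading_inclusion => //; first exact: (sX j).2.
    by move=> c /(sN j (leq_maxl _ _)); apply: u0.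
  have [|i|M sM] := krull_dcc (@fle_trans _) (s := fun i => s (N + i)%N) kN.
  - move=> i; split; last by apply: le_s; rewrite leq_addr.
    by move=> k u; apply.
  - by rewrite addnS; apply: ms.
  exists (N + M)%N => i NMi; have -> : i = (N + (i - N))%N.
    by rewrite subnKC // (leq_trans _ NMi) // leq_addr.
  by apply: sM; rewrite leq_subRL // (leq_trans _ NMi) // leq_addr.
have smono i c : leading (s i.+1) c -> leading (s i) c.
  by move=> [ws ws0 sK]; exists ws => // k u /ms; apply: sK.
have [N sN] := antitone_stable smono.
exists N => i Ni; apply: krull_leading => [||k u uX u0 ru]; first exact: ms.
  exact: (sX i.+1).2.
apply: leading_inclusion => //; first exact: (sX i).2.
move=> c Lc; apply: u0; apply: sN; first exact: leqW.
have desc j k1 : (j <= k1)%N -> leading (s k1) c -> leading (s j) c.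
  by move=> /subnK <-; elim: (k1 - j)%N => // l IH; rewrite addSn => /smono.
exact: desc Ni Lc.
Qed.

End Step.

(** * Functions killed by differences in three directions *)

Section Klein.
Variables (W N : zmodType) (k : nat).
Hypothesis W2 : forall x : W, x + x = 0.
Hypothesis N2 : forall x : N, x + x = 0.

Notation word := {ffun 'I_k -> W}.
Implicit Types (g : word -> N) (x h : word) (Q : {set 'I_k}) (r s : 'I_k) (a b c w : W).

(** The elements of the Klein four-group are 0 and three others, each the sum of
    the two remaining ones. *)
Definition klein a b c : Prop :=
  a + b = c /\ forall w, [\/ w = 0, w = a, w = b | w = c].

Lemma kleinR a b c : klein a b c -> klein b c a.
Proof.
case=> abc all4; split=> [|w].
  by rewrite -abc addrCA W2 addr0.
by case: (all4 w); [constructor 1 | constructor 4 | constructor 2 | constructor 3].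
Qed.

Definition set_at x r w : word := [ffun i => if i == r then w else x i].

(** The directions a in the rows of a subset of Q. *)
Definition rowdir Q a h : Prop :=
  forall i, (i \notin Q -> h i = 0) /\ (h i = 0 \/ h i = a).

Lemma rowdirS Q Q' a h : Q \subset Q' -> rowdir Q a h -> rowdir Q' a h.
Proof.
move=> QQ' Qh i; have [h0 ha] := Qh i; split=> // iQ'.
by apply: h0; apply: contraNN iQ'; apply: subsetP.
Qed.

Definition vanish_at g r : Prop := forall x, x r = 0 -> g x = 0.

(** With l_a the linear form that vanishes at a, this is the projection of the
    functions of rows r and s onto the line of l_a (x) l_a, whose coordinate is the
    value at (b, c): among the three lines only the one of a has nonzero values
    there. *)
Definition proj_line a b c r s g : word -> N := fun x =>
  if [&& x r != 0, x r != a, x s != 0 & x s != a]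
  then g (set_at (set_at x r b) s c) else 0.

Lemma set_at_add x h r w : h r = 0 -> set_at (x + h) r w = set_at x r w + h.
Proof.
by move=> h0; apply/ffunP => i; rewrite !ffunE; case: eqP => // ->; rewrite h0 addr0.
Qed.

Lemma diff_proj a b c r s g h : h r = 0 -> h s = 0 ->
  diff h (proj_line a b c r s g) = proj_line a b c r s (diff h g).
Proof.
move=> hr hs; apply/funext => x; rewrite /diff /proj_line !ffunE hr hs !addr0.
case: ifP => _; last by rewrite subr0.
by rewrite !set_at_add.
Qed.

Lemma van_proj a b c r s g Q (ws : seq W) : r \notin Q -> s \notin Q ->
  van (map (rowdir Q) ws) g -> van (map (rowdir Q) ws) (proj_line a b c r s g).
Proof.
move=> rQ sQ; elim: ws g => [|w ws IH] g /= vg.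
  by move=> x; rewrite /proj_line vg if_same.
move=> h Qh; rewrite diff_proj; first exact/IH/vg.
- by case: (Qh r) => ->.
- by case: (Qh s) => ->.
Qed.

Lemma van_proj_self a b c r s g :
  van [:: rowdir [set r; s] a] (proj_line a b c r s g).
Proof.
move=> h rsh x; apply/eqP; rewrite /diff subr_eq0; apply/eqP.
have stay i : ((x i + h i != 0) && (x i + h i != a)) = ((x i != 0) && (x i != a)).
  have [_ [->|->]] := rsh i; first by rewrite addr0.
  rewrite andbC; congr (~~ _ && ~~ _).
    by rewrite -{2}[a]add0r (inj_eq (addIr a)).
  by rewrite -[RHS](inj_eq (addIr a)) W2.
rewrite /proj_line !ffunE !andbA -(andbA (_ && _)) !stay andbA.
case: ifP => // _; congr (g _); apply/ffunP => i; rewrite !ffunE.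
case: eqP => // is_; case: eqP => // ir.
have [h0 _] := rsh i; rewrite h0 ?addr0 //.
by rewrite !inE; apply/norP; split; apply/eqP.
Qed.

Lemma vanish_at_proj a b c r s g i : vanish_at g i ->
  i != r -> i != s -> vanish_at (proj_line a b c r s g) i.
Proof.
move=> gi ir is_ x xi; rewrite /proj_line; case: ifP => // _.
by apply: gi; rewrite !ffunE (negPf ir) (negPf is_).
Qed.

Section TwoRows.
Variables (r s : 'I_k) (Q : {set 'I_k}).
Hypotheses (rs : r != s) (rQ : r \in Q) (sQ : s \in Q).

Lemma invariant_set_at g a x i w w' : i \in Q ->
  van [:: rowdir Q a] g -> w' = w + a ->
  g (set_at x i w') = g (set_at x i w).
Proof.
move=> iQ vg ->; have Qh : rowdir Q a [ffun j => if j == i then a else 0].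
  move=> j; rewrite ffunE; case: eqP => [->|_]; split=> //; [|by right|by left].
  by rewrite iQ.
have /eqP := vg _ Qh (set_at x i w); rewrite /diff subr_eq0 => /eqP <-.
by congr (g _); apply/ffunP => j; rewrite !ffunE; case: eqP; rewrite ?addr0.
Qed.

Lemma set_at2 x w w' : set_at (set_at x r w) s w' = set_at (set_at x s w') r w.
Proof.
apply/ffunP => i; rewrite !ffunE; case: eqP => // ->; case: eqP => // sr.
by move: rs; rewrite sr eqxx.
Qed.

Lemma set_at_id x i : set_at x i (x i) = x.
Proof. by apply/ffunP => j; rewrite !ffunE; case: eqP => // ->. Qed.

(** The value at (b, c) that defines the projection can be moved, along the
    direction w, to a place where one of the two rows is zero. *)
Lemma proj_other a b c w g : van [:: rowdir Q w] g ->
  vanish_at g r -> vanish_at g s -> b = w \/ c = w ->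
  forall x, proj_line a b c r s g x = 0.
Proof.
move=> vg gr gs bcw x; rewrite /proj_line; case: ifP => // _; case: bcw => ->.
  rewrite set_at2 (@invariant_set_at g w _ r 0 w rQ vg) ?add0r //.
  by apply: gr; rewrite ffunE eqxx.
rewrite (@invariant_set_at g w _ s 0 w sQ vg) ?add0r //.
by apply: gs; rewrite ffunE eqxx.
Qed.

(** A function of two rows that vanishes when either is zero and is invariant under
    a in both is a multiple of l_a (x) l_a. *)
Lemma proj_id a b c g : klein a b c -> van [:: rowdir Q a] g ->
  vanish_at g r -> vanish_at g s -> proj_line a b c r s g =1 g.
Proof.
move=> [abc all4] vg gr gs x.
have acb : c + a = b by rewrite -abc addrAC W2 add0r.
have gx0 i : i \in Q -> vanish_at g i -> x i = 0 \/ x i = a -> g x = 0.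
  move=> iQ gi xi; rewrite -(set_at_id x i).
  have -> : g (set_at x i (x i)) = g (set_at x i 0).
    by case: xi => -> //; apply: (@invariant_set_at g a); rewrite ?add0r.
  by apply: gi; rewrite ffunE eqxx.
have [xr0|xr0] := eqVneq (x r) 0.
  by rewrite /proj_line xr0 eqxx /= (gx0 r) //; left.
have [xra|xra] := eqVneq (x r) a.
  by rewrite /proj_line xra eqxx /= andbF (gx0 r) //; right.
have [xs0|xs0] := eqVneq (x s) 0.
  by rewrite /proj_line xs0 eqxx /= !andbF (gx0 s) //; left.
have [xsa|xsa] := eqVneq (x s) a.
  by rewrite /proj_line xsa eqxx /= !andbF (gx0 s) //; right.
have swap i y w1 w2 : i \in Q -> w1 = b \/ w1 = c -> w2 = b \/ w2 = c ->
    g (set_at y i w1) = g (set_at y i w2).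
  move=> iQ [->|->] [->|->] //; apply: (@invariant_set_at g a) => //.
  by rewrite addrC abc.
have bc i : x i != 0 -> x i != a -> x i = b \/ x i = c.
  by case: (all4 (x i)) => ->; rewrite ?eqxx // => _ _; [left | right].
rewrite /proj_line xr0 xra xs0 xsa /=.
rewrite (swap s _ c (x s)) //; [|by right|exact: bc].
rewrite set_at2 (swap r _ b (x r)) //; [|by left|exact: bc].
rewrite -set_at2 set_at_id; congr (g _); apply/ffunP => i.
by rewrite !ffunE; case: eqP => // ->.
Qed.

(** The component that lies in none of the three lines. *)
Definition proj_rest a b c g : word -> N := fun x =>
  g x - proj_line a b c r s g x - proj_line b c a r s g x - proj_line c a b r s g x.

Lemma proj_rest0 a b c w g : klein a b c -> w \in [:: a; b; c] ->
  van [:: rowdir Q w] g -> vanish_at g r -> vanish_at g s ->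
  forall x, proj_rest a b c g x = 0.
Proof.
move=> kl wabc vg gr gs x; rewrite /proj_rest.
move: wabc; rewrite !inE => /or3P [] /eqP wE; subst w.
- rewrite (proj_id kl vg) // (proj_other _ vg) ?(proj_other _ vg) ?subrr ?subr0 //.
    by left. by right.
- rewrite (proj_id (kleinR kl) vg) // !(proj_other _ vg) ?subr0 ?subrr //.
    by right. by left.
- rewrite (proj_id (kleinR (kleinR kl)) vg) // !(proj_other _ vg) ?subr0 ?subrr //.
    by left. by right.
Qed.

Lemma diff_coproj a b c g h : h r = 0 -> h s = 0 ->
  diff h (proj_rest a b c g) = proj_rest a b c (diff h g).
Proof.
move=> hr hs; apply/funext => x; rewrite /proj_rest -!diff_proj // /diff.
have sub4 (t u v w : N) : t - u - (v - w) = t - v - (u - w).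
  by rewrite !opprD !opprK addrACA.
by rewrite [LHS]sub4; congr (_ - _); rewrite [LHS]sub4; congr (_ - _); exact: sub4.
Qed.

(** If a component E kills the functions invariant under w in the two rows, then a
    difference along w can be dropped from the list at the cost of these rows. *)
Lemma van_consume (E : (word -> N) -> word -> N) w ws g :
  (forall g h, h r = 0 -> h s = 0 -> diff h (E g) = E (diff h g)) ->
  (forall g, van [:: rowdir Q w] g -> vanish_at g r -> vanish_at g s ->
     forall x, E g x = 0) ->
  van (map (rowdir Q) (w :: ws)) g -> vanish_at g r -> vanish_at g s ->
  van (map (rowdir (Q :\: [set r; s])) ws) (E g).
Proof.
move=> Ediff E0; elim: ws g => [|w' ws IH] g vg gr gs; first exact: E0.
move=> h Qh.
have hr : h r = 0 by case: (Qh r) => -> //; rewrite !inE eqxx.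
have hs : h s = 0 by case: (Qh s) => -> //; rewrite !inE eqxx orbT.
rewrite Ediff //; apply: IH.
- move=> h' Qh'; rewrite diffC; apply: vg => //.
  exact: rowdirS (subsetDl _ _) Qh.
- by move=> x xr; rewrite /diff !gr ?subr0 // ffunE xr hr addr0.
- by move=> x xs; rewrite /diff !gs ?subr0 // ffunE xs hs addr0.
Qed.

End TwoRows.

Lemma van_one_row g r a : van (nseq 2 (rowdir [set r] a)) g.
Proof.
rewrite /= => h1 rh1 h2 rh2 x.
have row h : rowdir [set r] a h -> h = [ffun i => if i == r then h r else 0].
  move=> rh; apply/ffunP => i; rewrite ffunE; case: eqP => [-> //|/eqP ir].
  by case: (rh i) => -> //; rewrite inE.
have diff0 (f : word -> N) : diff (0 : word) f = (fun _ => 0).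
  by apply/funext => y; rewrite /diff addr0 subrr.
have zero h : rowdir [set r] a h -> h r = 0 -> h = 0.
  move=> /row -> hr; apply/ffunP => i; rewrite !ffunE eqxx in hr *.
  by rewrite hr if_same.
case: (rh1 r).2 => [/(zero _ rh1) ->|h1a].
  by rewrite (diff0 g) /diff subrr.
case: (rh2 r).2 => [/(zero _ rh2) ->|h2a]; first by rewrite diff0.
have -> : h2 = h1 by rewrite (row _ rh1) (row _ rh2) h1a h2a.
have hh : h1 + h1 = 0 by apply/ffunP => i; rewrite !ffunE W2.
rewrite /diff -(addrA x) hh addr0.
have negN (y : N) : - y = y by apply/eqP; rewrite eq_sym -subr_eq0 opprK N2.
by rewrite !negN addrA -(addrA (g x)) N2 addr0 N2.
Qed.

Lemma rowdir_split Q1 Q2 Q a h : Q = Q1 :|: Q2 -> [disjoint Q1 & Q2] ->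
  rowdir Q a h ->
  exists h1 h2, [/\ rowdir Q1 a h1, rowdir Q2 a h2 & h = h1 + h2].
Proof.
move=> -> dis Qh; exists [ffun i => if i \in Q1 then h i else 0].
exists [ffun i => if i \in Q2 then h i else 0]; split.
- move=> i; rewrite ffunE; split=> [/negPf -> //|].
  by case: ifP => _; [exact: (Qh i).2 | left].
- move=> i; rewrite ffunE; split=> [/negPf -> //|].
  by case: ifP => _; [exact: (Qh i).2 | left].
apply/ffunP => i; rewrite !ffunE.
case: ifP => i1; case: ifP => i2; rewrite ?addr0 ?add0r //.
  by have := disjointFr dis i1; rewrite i2.
by case: (Qh i) => -> //; rewrite inE i1 i2.
Qed.

Lemma van_two_rows g r s a : r != s -> van (nseq 3 (rowdir [set r; s] a)) g.
Proof.
move=> rs; apply: (van_add_dir (d := 1) (e := 1) _ (@van_one_row g r a)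
  (@van_one_row g s a)) => h; apply: rowdir_split => //.
by rewrite disjoints1 inE.
Qed.

Lemma setD_cons2 r s (xs : seq 'I_k) : uniq [:: r, s & xs] ->
  [set i in [:: r, s & xs]] :\: [set r; s] = [set i in xs].
Proof.
rewrite /= inE negb_or -andbA => /and4P [_ rxs sxs _].
apply/setP => i; rewrite !inE.
case: (eqVneq i r) => [->|_] /=; first by rewrite (negPf rxs).
by case: (eqVneq i s) => [->|_] //=; rewrite (negPf sxs).
Qed.

Lemma rows_left r s (xs : seq 'I_k) : uniq [:: r, s & xs] ->
  ~: [set i in xs] = ~: [set i in [:: r, s & xs]] :|: [set r; s] /\
  [disjoint ~: [set i in [:: r, s & xs]] & [set r; s]].
Proof.
rewrite /= inE negb_or -andbA => /and4P [_ rxs sxs _]; split.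
  apply/setP => i; rewrite !inE.
  case: (eqVneq i r) => [->|_] /=; first by rewrite rxs ?orbT.
  by case: (eqVneq i s) => [->|_] //=; rewrite ?sxs ?orbT ?orbF.
rewrite disjoint_sym -setI_eq0; apply/eqP/setP => i; rewrite !inE.
by case: (eqVneq i r) => [->|_] //=; case: (eqVneq i s).
Qed.

Lemma proj_sum a b c r s g x : g x = proj_rest r s a b c g x +
  proj_line c a b r s g x + proj_line b c a r s g x + proj_line a b c r s g x.
Proof. by rewrite /proj_rest !subrK. Qed.

Section Peel.
Variables (a b c : W) (kl : klein a b c) (r s : 'I_k) (xs : seq 'I_k).
Hypothesis uxs : uniq [:: r, s & xs].
Let Q := [set i in [:: r, s & xs]].
Let Q' := [set i in xs].
Let rs : r != s.
Proof. by move: uxs; rewrite /= inE negb_or => /andP [/andP []]. Qed.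
Let rQ : r \in Q. Proof. by rewrite !inE eqxx. Qed.
Let sQ : s \in Q. Proof. by rewrite !inE eqxx orbT. Qed.

Lemma grow_rows g e w : van (nseq e.+1 (rowdir (~: Q) w)) g ->
  van (nseq e.+3 (rowdir (~: Q') w)) g.
Proof.
move=> vg; have [QQ dis] := rows_left uxs; rewrite -[e.+3]/(e.+2.+1) -addn2.
apply: (van_add_dir _ vg (@van_two_rows g r s w rs)) => h.
exact: rowdir_split QQ dis.
Qed.

Lemma van_proj_left a' b' c' g e w : van (nseq e (rowdir (~: Q) w)) g ->
  van (nseq e (rowdir (~: Q) w)) (proj_line a' b' c' r s g).
Proof.
have E f : van (nseq e (rowdir (~: Q) w)) f =
    van (map (rowdir (~: Q)) (nseq e w)) f by rewrite map_nseq.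
rewrite !E; apply: van_proj.
  by rewrite inE negbK.
by rewrite inE negbK.
Qed.

Lemma van_coproj_left a' b' c' g e w : van (nseq e (rowdir (~: Q) w)) g ->
  van (nseq e (rowdir (~: Q) w)) (proj_rest r s a' b' c' g).
Proof. by move=> vg; do 3!(apply: vanB; last exact: van_proj_left). Qed.

Lemma consume_proj a' b' c' w ws g : b' = w \/ c' = w ->
  van (map (rowdir Q) (w :: ws)) g -> vanish_at g r -> vanish_at g s ->
  van (map (rowdir Q') ws) (proj_line a' b' c' r s g).
Proof.
move=> bcw vg gr gs; rewrite -[Q'](setD_cons2 uxs).
apply: (van_consume (E := proj_line a' b' c' r s)) vg gr gs => //.
- by move=> f h; apply: diff_proj.
- by move=> f vf fr fs; apply: proj_other vf fr fs bcw.
Qed.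

Lemma consume_coproj w ws g : w \in [:: a; b; c] ->
  van (map (rowdir Q) (w :: ws)) g -> vanish_at g r -> vanish_at g s ->
  van (map (rowdir Q') ws) (proj_rest r s a b c g).
Proof.
move=> wabc vg gr gs; rewrite -[Q'](setD_cons2 uxs).
apply: (van_consume (E := proj_rest r s a b c)) vg gr gs => //.
- by move=> f h; apply: diff_coproj.
- by move=> f vf fr fs; apply: proj_rest0 kl wabc vf fr fs.
Qed.

Lemma keep_proj a' b' c' ws g : van (map (rowdir Q) ws) g ->
  van (map (rowdir Q') ws) (proj_line a' b' c' r s g).
Proof.
have rQ' : r \notin Q' by move: uxs; rewrite /= !inE negb_or -andbA => /and3P [].
have sQ' : s \notin Q' by move: uxs; rewrite /= !inE negb_or -!andbA => /and4P [].
move=> vg; apply: van_proj => //.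
elim: ws g vg => //= w ws IH g vg h Qh; apply/IH/vg; apply: rowdirS Qh.
by apply/subsetP => i; rewrite !inE => ->; rewrite !orbT.
Qed.

Lemma vanish_proj a' b' c' g : (forall i, i \in [:: r, s & xs] -> vanish_at g i) ->
  forall i, i \in xs -> vanish_at (proj_line a' b' c' r s g) i.
Proof.
move=> g0 i ixs; move: uxs; rewrite /= inE negb_or -andbA => /and4P [_ rxs sxs _].
apply: vanish_at_proj; first by apply: g0; rewrite !inE ixs !orbT.
  by apply: contraNneq rxs => <-.
by apply: contraNneq sxs => <-.
Qed.

Lemma vanish_coproj a' b' c' g : (forall i, i \in [:: r, s & xs] -> vanish_at g i) ->
  forall i, i \in xs -> vanish_at (proj_rest r s a' b' c' g) i.
Proof.
move=> g0 i ixs x xi; rewrite /proj_rest !(vanish_proj _ _ _ g0 ixs) // !subr0.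
by apply: g0 xi; rewrite !inE ixs !orbT.
Qed.

Lemma keep_degree b' c' g e : van (nseq e.+1 (rowdir (~: Q) a)) g ->
  van (nseq e.+1 (rowdir (~: Q') a)) (proj_line a b' c' r s g).
Proof.
move=> vg; have [QQ dis] := rows_left uxs.
apply: van_invar (van_proj_left _ _ _ vg) (@van_proj_self a b' c' r s g) => h.
exact: rowdir_split QQ dis.
Qed.

End Peel.

(** The component along l_a (x) l_a is invariant under a in the two rows and costs
    no degree; each of the other components costs degree 2 but consumes one of the
    d differences. *)
Lemma one_direction a b c D n (xs : seq 'I_k) g e d : klein a b c ->
  (size xs <= n)%N -> uniq xs -> (forall i, i \in xs -> vanish_at g i) ->
  van (map (rowdir [set i in xs]) (nseq d a)) g ->
  van (nseq e.+1 (rowdir (~: [set i in xs]) a)) g ->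
  (e + d.*2 < D)%N -> van (nseq D.+1 (rowdir setT a)) g.
Proof.
move=> kl; elim: n xs g e d => [|n IH] [|r [|s xs]] g e d //.
- move=> _ _ _ _ vg eD; have -> : [set: 'I_k] = ~: [set i in [::]].
    by apply/setP => i; rewrite !inE.
  apply: van_mono vg; rewrite ltnS; apply: leq_trans (ltnW eD); exact: leq_addr.
- move=> _ _ _ _ vg eD; have -> : [set: 'I_k] = ~: [set i in [::]].
    by apply/setP => i; rewrite !inE.
  apply: van_mono vg; rewrite ltnS; apply: leq_trans (ltnW eD); exact: leq_addr.
- move=> _ _ _ _ vg eD; apply: (van_mono (d := (e + 1).+1)).
    by rewrite ltnS addn1; apply: leq_trans eD; rewrite ltnS leq_addr.
  apply: (van_add_dir _ vg (@van_one_row g r a)) => h; apply: rowdir_split.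
    by apply/setP => i; rewrite !inE; case: eqP.
  by rewrite disjoint_sym disjoints1 !inE eqxx.
move=> sz uxs g0 vg vQ eD.
have szn : (size xs <= n)%N by apply: leq_trans _ (sz : (size (s :: xs) <= n)%N).
have uxs' : uniq xs by move: uxs => /= /and3P [].
have gr : vanish_at g r by apply: g0; rewrite inE eqxx.
have gs : vanish_at g s by apply: g0; rewrite !inE eqxx orbT.
have Pa : van (nseq D.+1 (rowdir setT a)) (proj_line a b c r s g).
  apply: (IH xs _ e d) => //; first exact: vanish_proj g0.
    exact: keep_proj vg.
  exact: keep_degree vQ.
apply: (van_ext (f := fun x => proj_rest r s a b c g x +
  proj_line c a b r s g x + proj_line b c a r s g x + proj_line a b c r s g x)).
  by move=> x; rewrite -proj_sum.
apply: vanD Pa; case: d vg eD => [|d] vg eD.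
  have z0 : g = fun _ => 0 by apply/funext => x; apply: vg.
  apply: (van_ext (f := fun _ => 0)); last exact: van0.
  move=> x; by rewrite /proj_rest /proj_line z0 !if_same !subr0 !addr0.
have eD' : (e.+2 + d.*2 < D)%N by rewrite doubleS -!addSnnS in eD.
(apply: vanD; first apply: vanD); apply: (IH xs _ e.+2 d) => //.
- exact: vanish_coproj g0.
- by apply: (consume_coproj kl uxs (w := a)) => //; rewrite inE eqxx.
- exact/(grow_rows uxs)/van_coproj_left.
- exact: vanish_proj g0.
- by apply: (consume_proj uxs _ (w := a)) => //; left.
- exact/(grow_rows uxs)/van_proj_left.
- exact: vanish_proj g0.
- by apply: (consume_proj uxs _ (w := a)) => //; right.
- exact/(grow_rows uxs)/van_proj_left.
Qed.

Section Decomposition.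
Variables (a b c : W) (P : N -> Prop).
Hypothesis kl : klein a b c.
Hypothesis P0 : P 0.
Hypothesis PD : forall y z, P y -> P z -> P (y + z).
Hypothesis PN : forall y, P y -> P (- y).

(** P is a property of the values that the three parts have to inherit. *)
Definition splits D g : Prop := exists g1 g2 g3,
  [/\ forall x, g x = g1 x + g2 x + g3 x,
      [/\ forall x, P (g1 x), forall x, P (g2 x) & forall x, P (g3 x)] &
      [/\ van (nseq D (rowdir setT a)) g1, van (nseq D (rowdir setT b)) g2
        & van (nseq D (rowdir setT c)) g3]].

Lemma splits_ext D g g' : g =1 g' -> splits D g -> splits D g'.
Proof. by move=> /funext ->. Qed.

Lemma splitsD D g g' : splits D g -> splits D g' -> splits D (fun x => g x + g' x).
Proof.
case=> [f1 [f2 [f3 [fE [p1 p2 p3] [v1 v2 v3]]]]].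
case=> [f1' [f2' [f3' [fE' [p1' p2' p3'] [v1' v2' v3']]]]].
exists (fun x => f1 x + f1' x), (fun x => f2 x + f2' x), (fun x => f3 x + f3' x).
split; last by split; apply: vanD.
  by move=> x; rewrite fE fE' addrACA (addrACA (f1 x)).
by split=> x; apply: PD.
Qed.

Lemma splits_one D g w : w \in [:: a; b; c] -> (forall x, P (g x)) ->
  van (nseq D (rowdir setT w)) g -> splits D g.
Proof.
move=> wabc Pg vg; have v0 v := van0 N (nseq D (rowdir setT v)).
move: wabc; rewrite !inE => /or3P [] /eqP wE; subst w.
- exists g, (fun _ => 0), (fun _ => 0); split=> //.
  by move=> x; rewrite !addr0.
- exists (fun _ => 0), g, (fun _ => 0); split=> //.
  by move=> x; rewrite addr0 add0r.
- exists (fun _ => 0), (fun _ => 0), g; split=> //.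
  by move=> x; rewrite !add0r.
Qed.

Lemma van_move_front (I : eqType) (M' N' : zmodType) (Dr : I -> M' -> Prop)
  (ws : seq I) (w : I) (f : M' -> N') :
  w \in ws -> van (map Dr ws) f -> van (map Dr (w :: rem w ws)) f.
Proof.
elim: ws f => //= w' ws IH f; rewrite inE.
case: (eqVneq w w') => [->|ww'] //= wws vf h Dh h' Dh'.
by rewrite diffC; apply: (IH _ wws (vf h' Dh')).
Qed.

Lemma P_proj a' b' c' r s g : (forall x, P (g x)) ->
  forall x, P (proj_line a' b' c' r s g x).
Proof. by move=> Pg x; rewrite /proj_line; case: ifP. Qed.

Lemma P_coproj a' b' c' r s g : (forall x, P (g x)) ->
  forall x, P (proj_rest r s a' b' c' g x).
Proof.
by move=> Pg x; do 3!(apply: PD; last by apply/PN/P_proj).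
Qed.

(** As long as two different vectors are left in ws, each of the four components
    of a pair of rows consumes one of them; then [one_direction] takes over. *)
Lemma all_directions D n (xs : seq 'I_k) g e (ws : seq W) :
  (size xs <= n)%N -> uniq xs -> (forall i, i \in xs -> vanish_at g i) ->
  (forall x, P (g x)) -> {subset ws <= [:: a; b; c]} ->
  van (map (rowdir [set i in xs]) ws) g ->
  (forall w, w \in [:: a; b; c] -> van (nseq e.+1 (rowdir (~: [set i in xs]) w)) g) ->
  (e + (size ws).*2 < D)%N -> splits D.+1 g.
Proof.
elim: n xs g e ws => [|n IH] xs g e ws sz uxs g0 Pg wsP vg vQ eD.
  have xs0 : xs = [::] by case: xs sz {uxs g0 vg vQ}.
  apply: (splits_one (w := a)) => //; first by rewrite inE eqxx.
  have -> : [set: 'I_k] = ~: [set i in xs] by apply/setP => i; rewrite xs0 !inE.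
  apply: van_mono (vQ a _); last by rewrite inE eqxx.
  by rewrite ltnS; apply: leq_trans (ltnW eD); exact: leq_addr.
have [[w wabc ws1]|mixed] := pselect (exists2 w, w \in [:: a; b; c] & all (pred1 w) ws).
  apply: (splits_one wabc) => //.
  have wsE : ws = nseq (size ws) w by apply/all_pred1P.
  have [b' [c' klw]] : exists b' c', klein w b' c'.
    move: wabc; rewrite !inE => /or3P [] /eqP ->.
    - by exists b, c.
    - by exists c, a; apply: kleinR.
    - by exists a, b; apply/kleinR/kleinR.
  apply: (one_direction (xs := xs) (e := e) (d := size ws) klw (leqnn _)) => //.
    by rewrite -wsE.
  exact: vQ.
case: xs sz uxs g0 vg vQ => [|r [|s xs]] sz uxs g0 vg vQ.
- apply: (splits_one (w := a)) => //; first by rewrite inE eqxx.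
  have -> : [set: 'I_k] = ~: [set i in [::]] by apply/setP => i; rewrite !inE.
  apply: van_mono (vQ a _); last by rewrite inE eqxx.
  by rewrite ltnS; apply: leq_trans (ltnW eD); exact: leq_addr.
- apply: (splits_one (w := a)) => //; first by rewrite inE eqxx.
  apply: (van_mono (d := (e + 1).+1)).
    by rewrite ltnS addn1; apply: leq_trans eD; rewrite ltnS leq_addr.
  apply: (van_add_dir _ (vQ a _) (@van_one_row g r a)) => [h|].
    apply: rowdir_split; first by apply/setP => i; rewrite !inE; case: eqP.
    by rewrite disjoint_sym disjoints1 !inE eqxx.
  by rewrite inE eqxx.
have szn : (size xs <= n)%N by apply: leq_trans _ (sz : (size (s :: xs) <= n)%N).
have uxs' : uniq xs by move: uxs => /= /and3P [].
have gr : vanish_at g r by apply: g0; rewrite inE eqxx.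
have gs : vanish_at g s by apply: g0; rewrite !inE eqxx orbT.
have step w : w \in ws -> (e.+2 + (size (rem w ws)).*2 < D)%N.
  move=> wws; have sw : (size ws).-1.+1 = size ws.
    by rewrite prednK // -has_predT; apply/hasP; exists w.
  by rewrite size_rem // !addSnnS -doubleS sw.
have subrem w : {subset rem w ws <= [:: a; b; c]}.
  by move=> v /mem_rem /wsP.
have other w : w \in [:: a; b; c] -> exists2 v, v \in ws & v != w.
  move=> wabc; apply: contrapT => no; apply: mixed; exists w => //.
  apply/allP => v vws /=; apply: contrapT => /negP vw; apply: no.
  by exists v.
have Pproj a' b' c' : a' \in [:: a; b; c] ->
    (forall v, v \in [:: a; b; c] -> v != a' -> b' = v \/ c' = v) ->
    splits D.+1 (proj_line a' b' c' r s g).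
  move=> a'abc bcP; have [w wws wa'] := other a' a'abc.
  apply: (IH xs _ e.+2 (rem w ws)) => //; last exact: step.
  - exact: vanish_proj g0.
  - exact: P_proj.
  - apply: (consume_proj uxs _ (w := w)) => //; first exact: bcP (wsP w wws) wa'.
    exact: van_move_front.
  - by move=> v /vQ vv; apply/(grow_rows uxs)/van_proj_left.
apply: (@splits_ext _ (fun x => proj_rest r s a b c g x +
  proj_line c a b r s g x + proj_line b c a r s g x + proj_line a b c r s g x)).
  by move=> x; rewrite -proj_sum.
apply: splitsD; last first.
  apply: Pproj; rewrite ?inE ?eqxx // => v; rewrite !inE.
  by move=> /or3P [] /eqP ->; rewrite ?eqxx //; [left | right].
apply: splitsD; last first.
  apply: Pproj; rewrite ?inE ?eqxx ?orbT // => v; rewrite !inE.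
  by move=> /or3P [] /eqP ->; rewrite ?eqxx //; [right | left].
apply: splitsD; last first.
  apply: Pproj; rewrite ?inE ?eqxx ?orbT // => v; rewrite !inE.
  by move=> /or3P [] /eqP ->; rewrite ?eqxx //; [left | right].
have [|w wws _] := other a; first by rewrite inE eqxx.
apply: (IH xs _ e.+2 (rem w ws)) => //; last exact: step.
- exact: vanish_coproj g0.
- exact: P_coproj.
- apply: (consume_coproj kl uxs (w := w)) => //; first exact: wsP.
  exact: van_move_front.
- by move=> v /vQ vv; apply/(grow_rows uxs)/van_coproj_left.
Qed.

Definition erase r g : word -> N := fun x => g (set_at x r 0).

(** Row after row, g is the sum of a function that does not depend on the row and
    of one that vanishes when the row is zero; xs collects the rows of the second
    kind. *)
Lemma split_rows D (ys xs : seq 'I_k) g (ws : seq W) :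
  uniq (xs ++ ys) -> (forall i, i \in xs -> vanish_at g i) ->
  (forall x h, (forall i, i \in xs ++ ys -> h i = 0) -> g (x + h) = g x) ->
  (forall x, P (g x)) -> {subset ws <= [:: a; b; c]} ->
  van (map (rowdir setT) ws) g -> ((size ws).*2 < D)%N -> splits D.+1 g.
Proof.
elim: ys xs g => [|y ys IH] xs g uxs g0 gc Pg wsP vg wD.
  rewrite cats0 in uxs gc.
  have vQ : van (map (rowdir [set i in xs]) ws) g.
    elim: ws {wsP wD} g vg {g0 gc Pg} => //= w ws IHw g vg h Qh.
    by apply/IHw/vg; apply: rowdirS Qh; apply: subsetT.
  apply: (all_directions (xs := xs) (e := 0%N) (ws := ws) (leqnn _)) => //.
  move=> w _ /= h Qh x.
  rewrite /diff gc ?subrr // => i ixs; case: (Qh i) => h0 _; apply: h0.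
  by rewrite !inE negbK.
have yxs : y \notin xs ++ ys.
  by rewrite (perm_uniq (permEl (perm_catCA xs [:: y] ys))) /= in uxs; case/andP: uxs.
have uxy : uniq (xs ++ ys).
  by rewrite (perm_uniq (permEl (perm_catCA xs [:: y] ys))) /= in uxs; case/andP: uxs.
have perm i : (i \in xs ++ y :: ys) = (i == y) || (i \in xs ++ ys).
  by rewrite !mem_cat inE orbCA.
have set_at0D x h : set_at (x + h) y 0 = set_at x y 0 + set_at h y 0.
  by apply/ffunP => i; rewrite !ffunE; case: eqP; rewrite ?addr0.
have ve : van (map (rowdir setT) ws) (erase y g).
  have LD : {morph (fun x => set_at x y 0) : x h / x + h} by exact: set_at0D.
  apply: van_ext (van_comp_map 0 LD _ vg) => [x|w h _ Qh i].
    by rewrite /erase add0r.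
  rewrite ffunE; split; first by rewrite inE.
  by case: eqP => _; [left | exact: (Qh i).2].
apply: (@splits_ext _ (fun x => erase y g x + (g x - erase y g x))).
  by move=> x; rewrite addrC subrK.
apply: splitsD.
  apply: (IH xs) => //.
  - move=> i ixs x xi; rewrite /erase; apply: (g0 i ixs); rewrite ffunE xi.
    exact: if_same.
  - move=> x h h0; rewrite /erase set_at0D gc // => i; rewrite perm ffunE.
    by case: eqP => //= _; apply: h0.
  - by move=> x; apply: Pg.
apply: (IH (y :: xs)) => //.
- by rewrite /= yxs.
- move=> i; rewrite inE => /orP [/eqP -> x xy|ixs x xi].
    rewrite /erase; have -> : set_at x y 0 = x by rewrite -xy set_at_id.
    by rewrite subrr.
  by rewrite /erase !(g0 i ixs) ?subrr // ffunE xi if_same.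
- move=> x h h0; have h1 i : i \in xs ++ y :: ys -> h i = 0.
    by rewrite perm => ii; apply: h0; rewrite inE.
  rewrite /erase set_at0D (gc _ _ h1) (gc _ (set_at h y 0)) // => i /h1 hi.
  by rewrite ffunE hi if_same.
- by move=> x; apply: PD => //; apply: PN; apply: Pg.
- exact: vanB.
Qed.

Theorem split_directions g (ws : seq W) : (forall x, P (g x)) ->
  {subset ws <= [:: a; b; c]} -> van (map (rowdir setT) ws) g ->
  splits (size ws).*2.+2 g.
Proof.
move=> Pg wsP vg; apply: (split_rows (xs := [::]) (ys := enum 'I_k)) vg _ => //.
  by rewrite /= enum_uniq.
move=> x h h0; congr (g _); apply/ffunP => i; rewrite ffunE h0 ?addr0 //.
by rewrite /= mem_enum.
Qed.

End Decomposition.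
End Klein.

(** * Krull dimension of functions of bounded degree *)

(** The functions that have moreover degree less than d along w. *)
Definition linefam m r e d (w : 'rV['F_2]_m) : fam (m + r) :=
  fcap (polyfam m r e) (vfam (nseq d (head_dirs r w))).

Lemma linefamE m r e d w k (u : Fun k (m + r)) :
  linefam r e d w k u = (polyfam m r e k u /\ van (nseq d (@along m r k w)) u).
Proof. by rewrite /= !map_nseq head_dirsE. Qed.

(** In a basis of F_2^m that ends with w, these are functions of bounded degree in
    all but m - 1 columns. *)
Lemma krull_line m r e d (w : 'rV['F_2]_m) : w != 0 ->
  (forall r' e', fkrull m (fzero _) (polyfam m.-1 r' e')) ->
  fkrull m (fzero _) (linefam r e d w).
Proof.
move=> w0 kX.
have [q [j wC]] : exists (q : 'M_(m, m.-1)) (j : 'M_(m.-1, m)), w^C%MS = q *m j.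
  by apply: factor_rank; rewrite mxrank_compl rank_rV w0 subn1.
have [l [x one]] : exists (l : 'cV_m) (x : 'M_(m, m.-1)), 1%:M = l *m w + x *m j.
  have : (1%:M <= w + w^C)%MS by rewrite submx_full // addsmx_compl_full.
  move=> /sub_addsmxP [[l x] /= ->]; exists l, (x *m q).
  by rewrite wC mulmxA.
pose B := col_mx (row_mx j 0) (col_mx (row_mx w 0) (row_mx 0 1%:M)) :
  'M['F_2]_(m.-1 + (1 + r), m + r).
have BE k (a : 'M_(k, m.-1)) (s : 'cV_k) (z : 'M_(k, r)) :
    row_mx a (row_mx s z) *m B = row_mx (a *m j + s *m w) z.
  by rewrite !mul_row_col !mul_mx_row !mulmx0 mulmx1 !add_row_mx !addr0 !add0r.
apply: (krull_pull (c := delta_ffun B) (t := polyfam m.-1 (1 + r) (d + e))) => //.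
- exact: fzero_le.
- move=> k u; rewrite linefamE !polyfamE => -[vz vw].
  have v : van (nseq (d + e) (fun h : 'M_(k, m + r) => exists a b,
      [/\ along w a, lsubmx b = 0 & h = a + b])) u.
    case: d vw => [|d] vw.
      apply: (van_ext (f := fun _ => 0)); last exact: van0.
      by move=> y; rewrite vw.
    case: e vz => [|e] vz.
      apply: (van_ext (f := fun _ => 0)); last exact: van0.
      by move=> y; rewrite vz.
    apply: (van_mono (d := (d + e).+1)); first by rewrite addSn addnS ltnS leqnSn.
    exact: van_add_dir vw vz.
  have LD : {morph (fun y : 'M['F_2]_(k, m.-1 + (1 + r)) => y *m B) : y z / y + z}.
    by move=> y z; rewrite mulmxDl.
  apply: van_ext (van_comp_nseq 0 LD _ v) => [y|h h0].
    by rewrite pull_delta add0r.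
  exists (row_mx (lsubmx (rsubmx h) *m w) 0), (row_mx 0 (rsubmx (rsubmx h))).
  split; [by exists (lsubmx (rsubmx h)) | exact: row_mxKl |].
  rewrite -{1}[h]hsubmxK h0 -{1}[rsubmx h]hsubmxK BE mul0mx add0r.
  by rewrite add_row_mx addr0 add0r.
- apply: (krull_le (@fle_trans _)) => k u [_ /= u0]; split=> //.
  apply/ffunP => y; rewrite [RHS]ffunE.
  have /ffunP /(_ (row_mx (lsubmx y *m x) (row_mx (lsubmx y *m l) (rsubmx y)))) := u0.
  rewrite pull_delta BE -!mulmxA -mulmxDr addrC -one mulmx1 hsubmxK => ->.
  by rewrite ffunE.
Qed.

Theorem krull_poly0 r e : fkrull 1 (fzero _) (polyfam 0 r e).
Proof.
apply: krull_step => // ws ws0 k u; rewrite dirfamE => -[_].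
case: ws ws0 => [|w ws] /=; last by rewrite (thinmx0 w) eqxx.
by move=> _ u0 /=; apply/ffunP => x; rewrite u0 ffunE.
Qed.

(** There is only one nonzero vector in F_2^1. *)
Theorem krull_poly1 r e : fkrull 2 (fzero _) (polyfam 1 r e).
Proof.
apply: krull_step => [_|ws ws0]; first exact: krull_poly0.
have w1 : (1%:M : 'rV['F_2]_1) != 0 by rewrite -mxrank_eq0 mxrank1.
have wsE : ws = nseq (size ws) 1%:M.
  apply/all_pred1P/allP => w /(allP ws0) w0 /=; apply/eqP.
  rewrite [w]mx11_scalar; case: (F2_cases (w 0 0)) => wz; last by rewrite wz.
  by move: w0; rewrite [w]mx11_scalar wz raddf0 eqxx.
apply: (krull_between (@fle_refl _) (@fle_trans _)
  (krull_line e e (size ws) w1 krull_poly0)) => // k u.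
by rewrite dirfamE linefamE {1}wsE map_nseq.
Qed.

Definition wa : 'rV['F_2]_2 := delta_mx 0 0.
Definition wb : 'rV['F_2]_2 := delta_mx 0 1.
Definition wc : 'rV['F_2]_2 := wa + wb.

Lemma rV2_cases (w : 'rV['F_2]_2) : [\/ w = 0, w = wa, w = wb | w = wc].
Proof.
have E : w = w 0 0 *: wa + w 0 1 *: wb.
  apply/rowP => j; rewrite !mxE /=.
  case: j => [[|[|//]]] lt_j; rewrite ?mulr1 ?mulr0 ?addr0 ?add0r.
    by congr (w 0 _); apply: val_inj.
  by congr (w 0 _); apply: val_inj.
rewrite E /wc; case: (F2_cases (w 0 0)) => ->; case: (F2_cases (w 0 1)) => ->;
  rewrite ?scale0r ?scale1r ?addr0 ?add0r.
- by constructor 1.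
- by constructor 3.
- by constructor 2.
- by constructor 4.
Qed.

Lemma klein_rV2 : klein wa wb wc.
Proof. by split=> // w; apply: rV2_cases. Qed.

Lemma rows_morph k n :
  {morph (fun x : {ffun 'I_k -> 'rV['F_2]_n} => \matrix_(i < k) x i) :
    x y / x + y}.
Proof. by move=> x y; apply/row_matrixP => i; rewrite linearD /= !rowK ffunE. Qed.

(** Functions of the two groups of columns are seen as functions of the rows of the
    first, with values in functions of the second of degree less than e. *)
Lemma dirfam_split r e (ws : seq 'rV['F_2]_2) : all (fun w => w != 0) ws ->
  let S w := linefam r e (size ws).*2.+2 w in
  fle (dirfam r e ws) (fadd (S wa) (fadd (S wb) (S wc))).
Proof.
move=> ws0 S k u; rewrite dirfamE polyfamE => -[vz vw].
pose g (x : {ffun 'I_k -> 'rV['F_2]_2}) : {ffun 'M['F_2]_(k, r) -> 'F_2} :=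
  [ffun z => u (row_mx (\matrix_(i < k) x i) z)].
pose P (y : {ffun 'M['F_2]_(k, r) -> 'F_2}) := van (nseq e (fun _ => True)) y.
have zero_ffun (y : {ffun 'M['F_2]_(k, r) -> 'F_2}) : y =1 (fun _ => 0) -> P y.
  move=> y0; apply: (van_ext (f := fun _ => 0)); last exact: van0.
  by move=> z; rewrite y0.
have rV2_addxx (w : 'rV['F_2]_2) : w + w = 0.
  by apply/rowP => j; rewrite !mxE F2_addxx.
have ffun_addxx (y : {ffun 'M['F_2]_(k, r) -> 'F_2}) : y + y = 0.
  by apply/ffunP => z; rewrite !ffunE F2_addxx.
have P0 : P 0 by apply: zero_ffun => z; rewrite ffunE.
have PD y z : P y -> P z -> P (y + z).
  by move=> Py Pz; apply: van_ext (vanD Py Pz) => x; rewrite ffunE.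
have PN y : P y -> P (- y).
  by move=> Py; apply: van_ext (vanN Py) => x; rewrite ffunE.
have Pg x : P (g x).
  have LD : {morph (fun z : 'M['F_2]_(k, r) => row_mx 0 z : 'M_(k, 2 + r)) :
      y z / y + z}.
    by move=> y z; rewrite add_row_mx addr0.
  have := van_comp_nseq (D' := fun _ => True) (row_mx (\matrix_(i < k) x i) 0) LD _ vz.
  move=> /(_ (fun h _ => row_mxKl _ _)); apply: van_ext => z.
  by rewrite ffunE add_row_mx addr0 add0r.
have wsP : {subset ws <= [:: wa; wb; wc]}.
  move=> w /(allP ws0) w0; rewrite !inE.
  by case: (rV2_cases w) => wE; rewrite wE ?eqxx ?orbT // in w0 *.
have rowsL k' : {morph (fun x : {ffun 'I_k' -> 'rV['F_2]_2} =>
    row_mx (\matrix_(i < k') x i) 0 : 'M['F_2]_(k', 2 + r)) : x y / x + y}.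
  by move=> x y; rewrite rows_morph add_row_mx addr0.
have vg : van (map (rowdir setT) ws) g.
  apply/van_ffun => z.
  have vA := @van_comp_map _ _ _ _ u _ ws _ (rowdir setT) (row_mx 0 z) (rowsL k) _ vw.
  apply: van_ext (vA _) => [x|w h _ Qh].
    by rewrite ffunE add_row_mx add0r addr0.
  exists (\col_i (h i == w)%:R); congr (row_mx _ _).
  apply/row_matrixP => i; rewrite rowK row_mul [row i _]mx11_scalar !mxE mul_scalar_mx.
  case: eqVneq => [->|hw]; first by rewrite scale1r.
  by rewrite scale0r; case: (Qh i) => _ [|hw'] //; rewrite hw' eqxx in hw.
have [g1 [g2 [g3 [gE [P1 P2 P3] [v1 v2 v3]]]]] :=
  split_directions rV2_addxx ffun_addxx klein_rV2 P0 PD PN Pg wsP vg.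
pose back (f : {ffun 'I_k -> 'rV['F_2]_2} -> {ffun 'M['F_2]_(k, r) -> 'F_2}) :
  Fun k (2 + r) := [ffun b : 'M_(k, 2 + r) =>
    f [ffun i => row i (lsubmx b)] (rsubmx b)].
have backS w f : (forall x, P (f x)) -> van (nseq (size ws).*2.+2 (rowdir setT w)) f ->
    S w k (back f).
  move=> Pf vf; rewrite linefamE polyfamE; split.
    have LD : {morph (fun z : 'M['F_2]_(k, r) => row_mx 0 z : 'M_(k, 2 + r)) :
      y z / y + z}.
      by move=> y z; rewrite add_row_mx addr0.
    apply: (van_fiber (D' := fun _ => True) LD) => [h h0|x].
      by exists (rsubmx h); rewrite // -{1}[h]hsubmxK h0.
    pose x1 := [ffun i => row i (lsubmx x)].
    apply: van_ext (van_shift (rsubmx x) (Pf x1)) => z.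
    have -> : z + rsubmx x = rsubmx (x + row_mx 0 z).
      by rewrite linearD /= row_mxKr addrC.
    rewrite ffunE; congr (f _ _).
    have -> : lsubmx (x + row_mx 0 z) = lsubmx x by rewrite linearD /= row_mxKl addr0.
    by [].
  apply: (van_fiber (D' := rowdir setT w) (rowsL k)) => [h [l ->]|x].
    exists [ffun i => row i (l *m w)].
      move=> i; rewrite inE ffunE; split=> //.
      rewrite row_mul [row i l]mx11_scalar mul_scalar_mx.
      case: (F2_cases (row i l 0 0)) => ->; rewrite ?scale0r ?scale1r.
        by left.
      by right.
    congr (row_mx _ _); apply/row_matrixP => i.
    by rewrite rowK ffunE.
  pose x1 := [ffun i => row i (lsubmx x)].
  have /van_ffun/(_ (rsubmx x)) := van_shift x1 vf; apply: van_ext => y.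
  set m := row_mx _ _; have -> : rsubmx x = rsubmx (x + m).
    by rewrite linearD /= row_mxKr addr0.
  rewrite ffunE; congr (f _ _); apply/ffunP => i.
  have lm : lsubmx (x + m) = lsubmx x + \matrix_(i < k) y i.
    by rewrite linearD /= row_mxKl.
  by rewrite !ffunE lm linearD /= rowK addrC.
exists (back g1), (back g2 + back g3); split; first exact: backS.
  by exists (back g2), (back g3); split=> //; apply: backS.
apply/ffunP => b; pose x := [ffun i => row i (lsubmx b)].
have -> : u b = g x (rsubmx b).
  rewrite ffunE; have -> : \matrix_(i < k) x i = lsubmx b.
    by apply/row_matrixP => i; rewrite rowK ffunE.
  by rewrite hsubmxK.
by rewrite gE !ffunE addrA.
Qed.

Theorem krull_poly2 r e : fkrull 3 (fzero _) (polyfam 2 r e).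
Proof.
apply: krull_step => [_|ws ws0]; first exact: krull_poly1.
have nz i : delta_mx 0 i != 0 :> 'rV['F_2]_2.
  by apply/eqP => /rowP /(_ i); rewrite !mxE !eqxx.
have wc0 : wc != 0.
  by apply/eqP => /rowP /(_ 0); rewrite !mxE.
apply: (krull_between (@fle_refl _) (@fle_trans _) _ (@fle_refl _ _)
  (dirfam_split ws0)).
apply: krull_fadd; last apply: krull_fadd.
- by apply: krull_line (nz 0) _ => r' e'; apply: krull_poly1.
- by apply: krull_line (nz 1) _ => r' e'; apply: krull_poly1.
- by apply: krull_line wc0 _ => r' e'; apply: krull_poly1.
Qed.

(** * Evaluation of tensors at linear forms *)

Lemma presented_ind (X : choiceType) (A : {malg 'F_2[X]} -> Prop)
  (P : presented A -> Prop) : P 0 -> (forall x y, P x -> P y -> P (x + y)) ->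
  (forall x, P (pgen A x)) -> forall q, P q.
Proof.
move=> P0 PD Pg q; rewrite -[q]repK [rep q]monalgE linear_sum.
apply: big_ind => // x _; set c := (rep q)@_x.
have -> : << c *g x >> = c *: (<< x >> : {malg 'F_2[X]}).
  by apply/malgP => k; rewrite mcoeffZ !mcoeffU mulrnAr mulr1.
rewrite linearZ /=; case: (F2_cases c) => ->; first by rewrite scale0r.
by rewrite scale1r; apply: Pg.
Qed.

Section TensorAdditive.
Variables U W : lmodType 'F_2.

Lemma ptensorDl (u u' : U) (w : W) :
  ptensor (u + u') w = ptensor u w + ptensor u' w.
Proof. by rewrite -[u]scale1r ptensorPl !scale1r. Qed.

Lemma ptensorDr (u : U) (w w' : W) :
  ptensor u (w + w') = ptensor u w + ptensor u w'.
Proof. by rewrite -[w]scale1r ptensorPr !scale1r. Qed.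

Lemma ptensor0l (w : W) : ptensor (0 : U) w = 0.
Proof. by apply: (addrI (ptensor 0 w)); rewrite -ptensorDl !addr0. Qed.

Lemma ptensor0r (u : U) : ptensor u (0 : W) = 0.
Proof. by apply: (addrI (ptensor u 0)); rewrite -ptensorDr !addr0. Qed.

Variables (f : {linear U -> ('F_2)^o}) (g : {linear W -> ('F_2)^o}).

Definition pairing_on (p : U * W) : ('F_2)^o := f p.1 * g p.2.

Fact pairing_rel r : tensor_rel r -> free_ext pairing_on r = 0.
Proof.
case=> [a u u' w|a u w w']; rewrite linearB linearP /= !free_extU /pairing_on /=.
- by rewrite linearP mulrDl -[_ *: _ * _]mulrA subrr.
- by rewrite linearP mulrDr -[_ * (_ *: _)]mulrCA subrr.
Qed.

Definition pairing : {linear tensor U W -> ('F_2)^o} := plift pairing_rel.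

Lemma pairingE u w : pairing (ptensor u w) = f u * g w.
Proof. exact: plift_gen. Qed.

End TensorAdditive.

Lemma tensor_ind (U W : lmodType 'F_2) (P : tensor U W -> Prop) : P 0 ->
  (forall x y, P x -> P y -> P (x + y)) -> (forall u w, P (ptensor u w)) ->
  forall q, P q.
Proof. by move=> P0 PD Pt; apply: presented_ind => // -[u w]; apply: Pt. Qed.

Section Evaluation.
Variable n : nat.

Definition form k (c : 'cV['F_2]_k) (v : 'rV['F_2]_k) : ('F_2)^o := (v *m c) 0 0.

Fact form_linear k (c : 'cV['F_2]_k) : linear (form c).
Proof. by move=> a v w; rewrite /form mulmxDl -scalemxAl !mxE. Qed.

HB.instance Definition _ k (c : 'cV['F_2]_k) :=
  GRing.isLinear.Build 'F_2 'rV['F_2]_k ('F_2)^o _ (form c) (form_linear c).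

Definition Form k (c : 'cV['F_2]_k) : 'Hom('rV['F_2]_k, ('F_2)^o) := linfun (form c).

Lemma Form_inj k : injective (@Form k).
Proof.
move=> c d /lfunP cd; apply/colP => i; have := cd (delta_mx 0 i).
by rewrite !lfunE /= /form -!rowE !mxE.
Qed.

Lemma Form_surj k (p : 'Hom('rV['F_2]_k, ('F_2)^o)) : exists c, p = Form c.
Proof.
exists (\col_i p (delta_mx 0 i)); apply/lfunP => v.
rewrite lfunE /= /form mxE [v in LHS]row_sum_delta linear_sum.
by apply: eq_bigr => i _; rewrite linearZ /= mxE.
Qed.

Definition at_form k (c : 'cV['F_2]_k) (u : Ifun 'rV['F_2]_k) : ('F_2)^o := u (Form c).

Fact at_form_linear k (c : 'cV['F_2]_k) : linear (at_form c).
Proof. by []. Qed.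

HB.instance Definition _ k (c : 'cV['F_2]_k) :=
  GRing.isLinear.Build 'F_2 (Ifun 'rV['F_2]_k) ('F_2)^o _
    (at_form c) (at_form_linear c).

Definition minor k (z : 'M['F_2]_(k, n)) (v : {ffun 'I_n -> 'rV['F_2]_k}) : ('F_2)^o :=
  \det ((\matrix_i v i) *m z).

Fact minor_rel k (z : 'M['F_2]_(k, n)) r : ext_rel r -> free_ext (minor z) r = 0.
Proof.
case=> [v i a x y|v i j ij vij]; last first.
  rewrite free_extU /minor; apply: (determinant_alternate ij) => l.
  by rewrite !mxE; apply: eq_bigr => q _; rewrite !mxE vij.
rewrite linearB linearP /= !free_extU /minor.
apply/eqP; rewrite subr_eq0; apply/eqP; rewrite -[X in _ = _ + X]mul1r.
apply: (@determinant_multilinear _ _ _ _ _ i).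
- by rewrite !row_mul !rowK !ffunE eqxx mulmxDl scalemxAl scale1r.
- apply/matrixP => p q; rewrite !mxE; apply: eq_bigr => l _.
  by rewrite !mxE !ffunE eq_sym (negPf (neq_lift _ _)).
- apply/matrixP => p q; rewrite !mxE; apply: eq_bigr => l _.
  by rewrite !mxE !ffunE eq_sym (negPf (neq_lift _ _)).
Qed.

Definition minor_form k (z : 'M['F_2]_(k, n)) :
  {linear ext_power n 'rV['F_2]_k -> ('F_2)^o} := plift (minor_rel z).

Lemma minor_formE k (z : 'M['F_2]_(k, n)) v :
  minor_form z (wedge v) = \det ((\matrix_i v i) *m z).
Proof. exact: plift_gen. Qed.

Notation A := (tensorF (tensorF Ifun Ifun) (Lambda n)).

(** The columns of b are the linear forms: two for the factors I, and n for the
    minor that evaluates the exterior power. *)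
Definition ev k (b : 'M['F_2]_(k, 2 + n)) : {linear A 'rV['F_2]_k -> ('F_2)^o} :=
  pairing (pairing (at_form (col 0 (lsubmx b))) (at_form (col 1 (lsubmx b))))
    (minor_form (rsubmx b)).

Lemma evE k (b : 'M['F_2]_(k, 2 + n)) u1 u2 v :
  ev b (ptensor (ptensor u1 u2) (wedge v)) =
  u1 (Form (col 0 (lsubmx b))) * u2 (Form (col 1 (lsubmx b))) *
  \det ((\matrix_i v i) *m rsubmx b).
Proof. by rewrite /ev !pairingE minor_formE. Qed.

Lemma evD k (b : 'M['F_2]_(k, 2 + n)) (x y : A 'rV['F_2]_k) :
  ev b (x + y) = ev b x + ev b y.
Proof. exact: linearD. Qed.

Lemma ev0 k (b : 'M['F_2]_(k, 2 + n)) : ev b (0 : A 'rV['F_2]_k) = 0.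
Proof. exact: linear0. Qed.

Lemma A_ind k (P : A 'rV['F_2]_k -> Prop) : P 0 ->
  (forall x y, P x -> P y -> P (x + y)) ->
  (forall u1 u2 v, P (ptensor (ptensor u1 u2) (wedge v))) -> forall x, P x.
Proof.
move=> P0 PD Pg; apply: tensor_ind => // t w.
elim/tensor_ind: t => [|t t' Pt Pt'|u1 u2].
- by rewrite ptensor0l.
- by rewrite ptensorDl; apply: PD.
elim/presented_ind: w => [|w w' Pw Pw'|v].
- by rewrite ptensor0r.
- by rewrite ptensorDr; apply: PD.
exact: Pg.
Qed.

Definition homx k k' (B : 'M['F_2]_(k, k')) : 'Hom('rV['F_2]_k, 'rV['F_2]_k') :=
  linfun (mulmxr B).

Lemma Form_homx k k' (B : 'M['F_2]_(k, k')) c :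
  (Form c \o homx B)%VF = Form (B *m c).
Proof.
by apply/lfunP => v; rewrite comp_lfunE !lfunE /= /form mulmxA.
Qed.

Lemma fmapD (F : functor) (V V' : vectType 'F_2) (f : 'Hom(V, V')) (x y : F V) :
  fmap F f (x + y) = fmap F f x + fmap F f y.
Proof. exact: linearD. Qed.

Lemma fmap_tensor (F G : functor) (V V' : vectType 'F_2) (f : 'Hom(V, V'))
  (x : F V) (y : G V) :
  fmap (tensorF F G) f (ptensor x y) = ptensor (fmap F f x) (fmap G f y).
Proof. exact: tensor_mapE. Qed.

Lemma fmap_Lambda (V V' : vectType 'F_2) (f : 'Hom(V, V')) (v : {ffun 'I_n -> V}) :
  fmap (Lambda n) f (wedge v) = wedge [ffun i => f (v i)].
Proof. exact: ext_power_mapE. Qed.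

Lemma fmap_gen (V V' : vectType 'F_2) (f : 'Hom(V, V')) u1 u2 (v : {ffun 'I_n -> V}) :
  fmap A f (ptensor (ptensor u1 u2) (wedge v)) =
  ptensor (ptensor (fmap Ifun f u1) (fmap Ifun f u2)) (wedge [ffun i => f (v i)]).
Proof.
apply: etrans (@fmap_tensor (tensorF Ifun Ifun) (Lambda n) _ _ f _ _) _.
by rewrite fmap_Lambda (@fmap_tensor Ifun Ifun).
Qed.

Lemma ev_natural k k' (B : 'M['F_2]_(k, k')) (b : 'M['F_2]_(k', 2 + n)) x :
  ev b (fmap A (homx B) x) = ev (B *m b) x.
Proof.
elim/A_ind: x => [|x y IHx IHy|u1 u2 v].
- by rewrite linear0 !ev0.
- rewrite fmapD 2!evD; exact: (congr2 +%R IHx IHy).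
rewrite fmap_gen !evE /= /precomp_dual !Form_homx.
rewrite -mulmx_lsub -mulmx_rsub !colE !mulmxA.
congr (_ * \det (_ *m _)); apply/row_matrixP => i.
by rewrite row_mul !rowK ffunE lfunE.
Qed.

Lemma van_const (M N : zmodType) (D : M -> Prop) (y : N) : van [:: D] (fun _ => y).
Proof. by move=> h _ x; rewrite /diff subrr. Qed.

Lemma van_prod (M : zmodType) (R : comNzRingType) (D : M -> Prop) (I : Type)
  (r : seq I) (F : I -> M -> R) : (forall i, van (nseq 2 D) (F i)) ->
  van (nseq (size r).+1 D) (fun x => \prod_(i <- r) F i x : R).
Proof.
move=> vF; elim: r => [|i r IH].
  apply: (van_ext (f := fun _ => 1 : R)); last exact: van_const.
  by move=> x; rewrite big_nil.
apply: van_ext (van_mul (d := 1) (vF i) IH) => x.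
by rewrite big_cons.
Qed.

Lemma det_degree : van (nseq n.+1 (fun _ => True)) (fun X : 'M['F_2]_n => \det X).
Proof.
rewrite /determinant; apply: van_sum => s _.
apply: (van_mul (d := 0) (e := n)); first exact: van_const.
have vP : van (nseq (size (enum 'I_n)).+1 (fun _ => True))
    (fun X : 'M['F_2]_n => \prod_(i <- enum 'I_n) X i (s i) : 'F_2).
  apply: van_prod => i /= h _ h' _ X.
  have cancel (a c : 'F_2) : a + c - a = c by rewrite addrAC subrr add0r.
  by rewrite /diff !mxE !cancel subrr.
rewrite size_enum_ord in vP; apply: van_ext vP => X.
by rewrite big_enum.
Qed.

(** The minor is a sum of products of n linear functions, and the two other factors
    do not involve the last n columns. *)
Lemma ev_degree k x :
  van (nseq n.+1 (fun h : 'M_(k, 2 + n) => lsubmx h = 0)) (fun b => ev b x : 'F_2).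
Proof.
elim/A_ind: x => [|x y vx vy|u1 u2 v].
- apply: (van_ext (f := fun _ => 0)); last exact: van0.
  by move=> b; rewrite linear0.
- by apply: van_ext (vanD vx vy) => b; rewrite evD.
pose V := \matrix_i v i.
have LD : {morph (fun b : 'M['F_2]_(k, 2 + n) => V *m rsubmx b) : x y / x + y}.
  by move=> x y; rewrite linearD mulmxDr.
have vdet := van_comp_nseq (D' := fun h : 'M_(k, 2 + n) => lsubmx h = 0) 0
  LD _ det_degree.
have vu : van (nseq 1 (fun h : 'M_(k, 2 + n) => lsubmx h = 0)) (fun b =>
    u1 (Form (col 0 (lsubmx b))) * u2 (Form (col 1 (lsubmx b))) : 'F_2).
  rewrite /= => h h0 b; apply/eqP; rewrite /diff subr_eq0.
  have -> : lsubmx (b + h) = lsubmx b by rewrite linearD /= h0 addr0.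
  by [].
apply: van_ext (van_mul vu (vdet _)) => // b.
by rewrite evE add0r.
Qed.

Definition spike k (c : 'cV['F_2]_k) : Ifun 'rV['F_2]_k :=
  fun p => ((p == Form c)%:R : ('F_2)^o).

Lemma I_ind k (P : Ifun 'rV['F_2]_k -> Prop) : P 0 ->
  (forall x y, P x -> P y -> P (x + y)) -> (forall c, P (spike c)) -> forall u, P u.
Proof.
move=> P0 PD Ps u; have -> : u = \sum_(c | u (Form c) != 0) spike c.
  apply/funext => p; have [d ->] := Form_surj p; rewrite fct_sumE big_mkcond /=.
  rewrite (bigD1 d) //= big1 => [|c cd].
    rewrite addr0 /spike eqxx.
    by case: (F2_cases (u (Form d))) => ->; rewrite ?eqxx ?oner_neq0.
  case: ifP => // _; rewrite /spike; case: eqP => // /Form_inj dc.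
  by rewrite dc eqxx in cd.
exact: big_ind.
Qed.

End Evaluation.

(** * Injectivity of the evaluation *)

Lemma combination_closed (M : lmodType 'F_2) (T : finType) (e : T -> M) :
  let P x := exists a : T -> 'F_2, x = \sum_t a t *: e t in
  [/\ P 0, forall x y, P x -> P y -> P (x + y) & forall t, P (e t)].
Proof.
split=> [|x y [a ->] [b ->]|t].
- by exists (fun _ => 0); rewrite big1 // => t _; rewrite scale0r.
- exists (fun t => a t + b t); rewrite -big_split /=; apply: eq_bigr => t _.
  by rewrite scalerDl.
exists (fun t' => (t' == t)%:R); rewrite (bigD1 t) //= eqxx scale1r.
by rewrite big1 ?addr0 // => t' /negPf ->; rewrite scale0r.
Qed.

Lemma combination_coef (M : lmodType 'F_2) (T : finType) (e : T -> M)
  (f : {linear M -> ('F_2)^o}) (a : T -> 'F_2) u :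
  (forall t, f (e t) = (t == u)%:R) -> f (\sum_t a t *: e t) = a u.
Proof.
move=> fe; rewrite linear_sum (bigD1 u) //= big1 => [|t /negPf tu].
  by rewrite linearZ /= fe eqxx addr0 -[RHS]mulr1.
by rewrite linearZ /= fe tu scaler0.
Qed.

Section Wedge.
Variable n : nat.

Lemma wedge_ffsetD (V : lmodType 'F_2) (v : {ffun 'I_n -> V}) i x y :
  wedge (ffset v i (x + y)) = wedge (ffset v i x) + wedge (ffset v i y).
Proof. by rewrite -[x]scale1r wedgeP !scale1r. Qed.

Lemma ffsetC (V : lmodType 'F_2) (v : {ffun 'I_n -> V}) i j x y : i != j ->
  ffset (ffset v i x) j y = ffset (ffset v j y) i x.
Proof.
move=> ij; apply/ffunP => l; rewrite !ffunE.
by case: (eqVneq l j) => [->|//]; rewrite eq_sym (negPf ij).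
Qed.

Lemma lmod2 (V : lmodType 'F_2) (x : V) : x + x = 0.
Proof. by rewrite -[x]scale1r -scalerDl F2_addxx scale0r. Qed.

Lemma wedge_tperm (V : lmodType 'F_2) (v : {ffun 'I_n -> V}) i j :
  wedge [ffun l => v (tperm i j l)] = wedge v.
Proof.
have [->|ij] := eqVneq i j.
  by congr wedge; apply/ffunP => l; rewrite ffunE tperm1 perm1.
pose f x y := wedge (ffset (ffset v i x) j y).
have fxx x : f x x = 0.
  by apply: (wedge_alt ij); rewrite !ffunE !eqxx (negPf ij).
have fDr x y y' : f x (y + y') = f x y + f x y' by rewrite /f wedge_ffsetD.
have fDl x x' y : f (x + x') y = f x y + f x' y.
  by rewrite /f !(ffsetC _ _ _ ij) wedge_ffsetD.
have swap x y : f x y = f y x.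
  have := fxx (x + y); rewrite fDr !fDl !fxx add0r addr0 => yx.
  by rewrite -[LHS]addr0 -(lmod2 (f y x)) addrA (addrC (f x y)) yx add0r.
have -> : v = ffset (ffset v i (v i)) j (v j).
  by apply/ffunP => l; rewrite !ffunE; case: eqP => [->|_] //; case: eqP => [->|].
set v' := ffset _ _ _ in swap *.
have -> : [ffun l => v' (tperm i j l)] = ffset (ffset v i (v j)) j (v i).
  apply/ffunP => l; rewrite !ffunE.
  case: tpermP => [->|->|/eqP li /eqP lj].
  - by rewrite !eqxx (negPf ij).
  - by rewrite (negPf ij) !eqxx.
  - by rewrite (negPf li) (negPf lj).
exact: swap.
Qed.

Lemma wedge_perm (V : lmodType 'F_2) (v : {ffun 'I_n -> V}) (s : 'S_n) :
  wedge [ffun l => v (s l)] = wedge v.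
Proof.
have [ts -> _] := prod_tpermP s; elim: ts v => [|[i j] ts IH] v.
  by congr wedge; apply/ffunP => l; rewrite ffunE big_nil perm1.
rewrite big_cons -(IH v) -[RHS](wedge_tperm _ i j); congr wedge.
by apply/ffunP => l; rewrite !ffunE permM.
Qed.

Variable k : nat.
Notation V := 'rV['F_2]_k.

(** The basis vectors with the indices s. *)
Definition unit_rows (s : {ffun 'I_n -> 'I_k}) : {ffun 'I_n -> V} :=
  [ffun i => delta_mx 0 (s i)].

(** One enumeration for each n-element set: in characteristic 2 the wedge product
    does not depend on the order. *)
Definition enumeration (S : {set 'I_k}) : option {ffun 'I_n -> 'I_k} :=
  [pick s : {ffun 'I_n -> 'I_k} | injectiveb s && (s @: setT == S)].

Definition wedge_set (S : {set 'I_k}) : ext_power n V :=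
  if enumeration S is Some s then wedge (unit_rows s) else 0.

Lemma wedge_unit_rows s :
  wedge (unit_rows s) = 0 \/ wedge (unit_rows s) = wedge_set (s @: setT).
Proof.
case: (boolP (injectiveb s)) => [/injectiveP s_inj|]; last first.
  move=> /injectivePn [i [j ij sij]]; left; apply: (wedge_alt ij).
  by rewrite !ffunE sij.
right; rewrite /wedge_set /enumeration; case: pickP => [s'|/(_ s)]; last first.
  by rewrite eqxx andbT; move/injectiveP: s_inj => ->.
move=> /andP [/injectiveP s'_inj /eqP im].
have /choice [f fP] i : exists j, s' i = s j.
  have : s' i \in s @: setT by rewrite -im imset_f.
  by case/imsetP => j _ ->; exists j.
have f_inj : injective f by move=> i j fij; apply: s'_inj; rewrite !fP fij.
rewrite -(wedge_perm _ (perm f_inj)); congr wedge; apply/ffunP => i.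
by rewrite !ffunE permE -fP.
Qed.

Lemma Lambda_ind (P : ext_power n V -> Prop) : P 0 ->
  (forall x y, P x -> P y -> P (x + y)) -> (forall S, P (wedge_set S)) ->
  forall w, P w.
Proof.
move=> P0 PD PS; apply: presented_ind => // v; rewrite -[pgen _ _]/(wedge v).
suff H (l : seq 'I_n) : forall v : {ffun 'I_n -> V},
    (forall i, i \notin l -> exists j, v i = delta_mx 0 j) -> P (wedge v).
  by apply: (H (enum 'I_n)) => i; rewrite mem_enum.
elim: l {v} => [|i l IH] v vP.
  have /choice [s sP] i : exists j, v i = delta_mx 0 j by apply: vP.
  have -> : v = unit_rows (finfun s) by apply/ffunP => i; rewrite !ffunE.
  by case: (wedge_unit_rows (finfun s)) => ->.
have -> : v = ffset v i (v i).
  by apply/ffunP => l'; rewrite ffunE; case: eqP => [->|].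
move: (v i) => x; rewrite (row_sum_delta x).
have w0 : wedge (ffset v i 0) = 0.
  by apply: (addrI (wedge (ffset v i 0))); rewrite -wedge_ffsetD !addr0.
apply: (big_ind (fun y => P (wedge (ffset v i y)))) => [|y z Py Pz|j _].
- by rewrite w0.
- by rewrite wedge_ffsetD; apply: PD.
case: (F2_cases (x 0 j)) => ->; first by rewrite scale0r w0.
rewrite scale1r; apply: IH => l' l'l; rewrite ffunE.
case: eqP => [_|/eqP l'i]; first by exists j.
by apply: vP; rewrite inE negb_or l'i.
Qed.

Notation A := (tensorF (tensorF Ifun Ifun) (Lambda n)).
Notation T := ('cV['F_2]_k * 'cV['F_2]_k * {set 'I_k})%type.

Definition spanning (t : T) : A V :=
  ptensor (ptensor (spike t.1.1) (spike t.1.2)) (wedge_set t.2).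

Lemma spanning0 c d S : enumeration S = None -> spanning (c, d, S) = 0.
Proof.
move=> eS; have wS : wedge_set S = 0 by rewrite /wedge_set eS.
have -> : spanning (c, d, S) =
  ptensor (ptensor (spike c) (spike d)) (wedge_set S) by [].
by rewrite wS; apply: ptensor0r.
Qed.

Lemma spanning_ind (P : A V -> Prop) : P 0 ->
  (forall x y, P x -> P y -> P (x + y)) -> (forall t, P (spanning t)) ->
  forall x, P x.
Proof.
move=> P0 PD Ps; apply: A_ind => // u1 u2 v; move: (wedge v) => w.
elim/I_ind: u1 => [|x y Px Py|c].
- by rewrite !ptensor0l.
- by rewrite !ptensorDl; apply: PD.
elim/I_ind: u2 => [|x y Px Py|d].
- by rewrite ptensor0r ptensor0l.
- by rewrite ptensorDr ptensorDl; apply: PD.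
elim/Lambda_ind: w => [|x y Px Py|S].
- by rewrite ptensor0r.
- by rewrite ptensorDr; apply: PD.
exact: (Ps (c, d, S)).
Qed.

Lemma spanning_sum x : exists a : T -> 'F_2, x = \sum_t a t *: spanning t.
Proof.
have [P0 PD Pe] := combination_closed spanning.
exact: (@spanning_ind _ P0 PD Pe).
Qed.

Definition test_point (c d : 'cV['F_2]_k) (s : {ffun 'I_n -> 'I_k}) :
    'M['F_2]_(k, 2 + n) :=
  row_mx (\matrix_(i, j) (if j == 0 then c i 0 else d i 0))
         (\matrix_(i, j) (i == s j)%:R).

(** The test points are dual to the spanning family. *)
Lemma ev_test_point c d S s (t : T) : enumeration S = Some s ->
  ev (test_point c d s) (spanning t) = (t == (c, d, S))%:R.
Proof.
move=> eS; case: t => [[c' d'] S'].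
have [s_inj im_s] : injective s /\ s @: setT = S.
  move: eS; rewrite /enumeration; case: pickP => // s0.
  by move=> /andP [/injectiveP inj /eqP im] [<-].
have -> : spanning (c', d', S') =
  ptensor (ptensor (spike c') (spike d')) (wedge_set S') by [].
rewrite /wedge_set; case eS': (enumeration S') => [s'|]; last first.
  have -> : (c', d', S') == (c, d, S) = false.
    by apply/eqP => -[_ _ SS]; rewrite SS eS in eS'.
  by apply: etrans (ev0 _); congr (ev _ _); apply: ptensor0r.
have [s'_inj im_s'] : injective s' /\ s' @: setT = S'.
  move: eS'; rewrite /enumeration; case: pickP => // s0.
  by move=> /andP [/injectiveP inj /eqP im] [<-].
rewrite evE row_mxKl row_mxKr /spike.
have -> : col 0 (\matrix_(i < k, j < 2) (if j == 0 then c i 0 else d i 0)) = c.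
  by apply/colP => i; rewrite !mxE.
have -> : col 1 (\matrix_(i < k, j < 2) (if j == 0 then c i 0 else d i 0)) = d.
  by apply/colP => i; rewrite !mxE.
rewrite !(inj_eq (@Form_inj k)) !xpair_eqE (eq_sym c) (eq_sym d).
set M := (X in \det X).
have ME i j : M i j = (s' i == s j)%:R.
  rewrite mxE (bigD1 (s' i)) //= big1 => [|l ls]; rewrite !mxE ?ffunE ?mxE.
    by rewrite !eqxx mul1r addr0.
  by rewrite (negPf ls) mul0r.
suff -> : \det M = (S' == S)%:R by rewrite -!natrM !mulnb.
have [SS|SS] := eqVneq S' S.
  have -> : M = 1%:M.
    apply/matrixP => i j; rewrite ME mxE; congr (_%:R).
    move: eS'; rewrite SS eS => -[->]; rewrite (inj_eq s'_inj).
    by [].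
  by rewrite det1.
have [i si] : exists i, s' i \notin S.
  apply: contrapT => no; case/negP: SS; rewrite eqEcard; apply/andP; split.
    apply/subsetP => x; rewrite -im_s' => /imsetP [i _ ->].
    by apply: contrapT => /negP ni; apply: no; exists i.
  by rewrite -im_s -im_s' !card_imset.
rewrite (expand_det_row _ i) big1 // => j _; rewrite ME.
case: eqP => [ss|_]; last by rewrite mul0r.
by rewrite ss -im_s imset_f in si.
Qed.

Lemma ev_injective (x : A V) : (forall b, ev b x = 0) -> x = 0.
Proof.
have [a ->] := spanning_sum x => ev0; apply: big1 => -[[c d] S] _.
case eS: (enumeration S) => [s|]; last first.
  by rewrite spanning0 // scaler0.
have := ev0 (test_point c d s).
rewrite (combination_coef a (fun t => ev_test_point c d t eS)) => ->.
by rewrite scale0r.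
Qed.

End Wedge.

Import passmx.

Section Embedding.
Variable n : nat.
Notation A := (tensorF (tensorF Ifun Ifun) (Lambda n)).

Definition ev_fun k (x : A 'rV['F_2]_k) : Fun k (2 + n) := [ffun b => ev b x].

Lemma ev_funD k (x y : A 'rV['F_2]_k) : ev_fun (x + y) = ev_fun x + ev_fun y.
Proof. by apply/ffunP => b; rewrite !ffunE evD. Qed.

Lemma ev_fun0 k : ev_fun (0 : A 'rV['F_2]_k) = 0.
Proof. by apply/ffunP => b; rewrite !ffunE linear0. Qed.

Lemma ev_fun_inj k : injective (@ev_fun k).
Proof.
move=> x y xy; apply/eqP; rewrite -subr_eq0; apply/eqP/ev_injective => b.
have evB : ev b (x - y) = ev b x - ev b y by exact: linearB.
move/ffunP: xy => /(_ b); rewrite !ffunE => xy.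
by apply: etrans evB _; apply/eqP; rewrite subr_eq0; apply/eqP.
Qed.

Definition image_fam (G : subfunctor A) : fam (2 + n).
Proof.
apply: (@Fam _ (fun k u =>
  exists2 x : A 'rV['F_2]_k, x \in G 'rV['F_2]_k & u = ev_fun x)).
- by move=> k; exists 0; rewrite ?ev_fun0 // rpred0.
- by move=> k _ _ [x Gx ->] [y Gy ->]; exists (x + y); rewrite ?ev_funD // rpredD.
move=> k k' B _ [x Gx ->]; exists (fmap A (homx B) x).
  exact: sub_stable.
by apply/ffunP => b; rewrite !ffunE ev_natural.
Defined.

(** A subfunctor is determined by its values on the spaces 'rV_k, where the
    evaluation is injective. *)
Lemma image_fam_reflect (G H : subfunctor A) :
  fle (image_fam H) (image_fam G) -> subf_le H G.
Proof.
move=> HG V x Hx.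
pose i : 'Hom(V, 'rV['F_2]_(\dim {:V})) := linfun (rVof (vbasis {:V})).
pose j : 'Hom('rV['F_2]_(\dim {:V}), V) := linfun (vecof (vbasis {:V})).
have ji : (j \o i)%VF = \1%VF.
  apply/lfunP => v; rewrite comp_lfunE /i /j !lfunE.
  exact: (rVofK (vbasisP _)).
have [|z Gz /ev_fun_inj zE] := HG _ (ev_fun (fmap A i x)).
  by exists (fmap A i x) => //; apply: sub_stable.
have -> : x = fmap A j z by rewrite -zE -fmap_comp ji fmap_id.
exact: sub_stable.
Qed.

Lemma krull_tensor : krull (@subf_le A) 3 (zero_sub A) (full_sub A).
Proof.
apply: (krull_transfer (@subf_refl A) (@subf_trans A)
  (le2 := @fle (2 + n)) (th := image_fam)).
- by move=> V x _; apply: full_subE.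
- move=> G H _ _ GH; split; last exact: image_fam_reflect.
  by move=> k u [x /GH Hx ->]; exists x.
apply: (krull_between (@fle_refl _) (@fle_trans _) (krull_poly2 n n.+1)).
  exact: fzero_le.
move=> k u [x _ ->]; rewrite polyfamE; apply: van_ext (ev_degree x) => b.
by rewrite ffunE.
Qed.

End Embedding.

Theorem mainTheorem4 (n : nat) :
  artinian 2 (tensorF (tensorF Ifun Ifun) (Lambda n)).
Proof. exact/krull_artinian/krull_tensor. Qed.
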